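(* The following assertions are equivalent: (1) $E^*$ is strictly convex. (2) If $\nu_1,\nu_2\in M_+(K\times B_{E^*})$ are such that $T^*\nu_1=T^*\nu_2$ and $\|\nu_1\|=\|\nu_2\|=\|T^*\nu_1\|$, then $\nu_1=\nu_2$. (3) If $\nu\in M_+(K\times B_{E^*})$ is such that $\|T^*\nu\|=\|\nu\|$, then $WT^*\nu=\nu$.
   Context: $\mathbb F\in\{\mathbb R,\mathbb C\}$ is the scalar field, $K$ is a nonempty compact Hausdorff space, $E$ is a Banach space over $\mathbb F$, and $B_{E^*}$ is the closed unit ball of $E^*$ with the weak$^*$ topology. For a compact space $X$, $M(X)$ is the space of $\mathbb F$-valued Radon measures on $X$ with the total variation norm and $M_+(X)$ its subset of positive measures. $C(K,E)$ is the space of continuous functions $K\to E$ with the sup norm. $M(K,E^* )$ is the space of regular $\sigma$-additive $E^*$-valued Borel measures $\mu$ on $K$ of bounded variation; $|\mu|$ is the variation and $\|\mu\|=|\mu|(K)$. For $\mathbf f\in C(K,E)$, $\int\mathbf f\,d\mu$ is the extension by uniform limits of $\int\sum_j\chi_{A_j}x_j\,d\mu=\sum_j\mu(A_j)(x_j)$; this identifies $M(K,E^* )$ isometrically with $C(K,E)^*$. The map $T:C(K,E)\to C(K\times B_{E^*})$ is $T\mathbf f(t,x^* )=x^*(\mathbf f(t))$. Its adjoint is viewed as $T^*:M(K\times B_{E^*})\to M(K,E^* )$, so $\int\mathbf f\,dT^*\nu=\int x^*(\mathbf f(t))\,d\nu(t,x^* )$ and $T^*\nu(A)(x)=\int_{A\times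 B_{E^*}}x^*(x)\,d\nu(t,x^* )$. Definition of $W$. Let $\mathcal D$ be the set of all $f:K\times E^*\to\mathbb R$ such that $f|_{K\times B_{E^*}}$ is upper semicontinuous and bounded and $f(t,\cdot)$ is superlinear (superadditive and positively homogeneous) for each $t\in K$. For $f\in\mathcal D$ and $\mu\in M(K,E^* )$ put $$p_f(\mu)=\inf\Big\{\operatorname{Re}\int\mathbf g\,d\mu:\ \mathbf g\in C(K,E),\ \operatorname{Re}x^*(\mathbf g(t))\ge f(t,x^* )\text{ for all }(t,x^* )\in K\times E^*\Big\}.$$ For $\mu\in M(K,E^* )$, $W\mu$ is the unique positive Radon measure on $K\times B_{E^*}$ with $\|W\mu\|=\|\mu\|$ and $\int f\,dW\mu=p_f(\mu)$ for all $f\in\mathcal D$ (existence and uniqueness are a theorem of Batty). It satisfies $T^*W\mu=\mu$. *)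

(* Defs.v *)
From HB Require Import structures.
From mathcomp Require Import all_boot all_order all_algebra.
From mathcomp Require Import all_classical all_reals all_analysis.
From mathcomp Require Import complex measurable_realfun lra.

Set Implicit Arguments.
Unset Strict Implicit.
Unset Printing Implicit Defensive.

Import Order.TTheory GRing.Theory Num.Theory.
Import numFieldNormedType.Exports.

Local Open Scope classical_set_scope.
Local Open Scope ring_scope.

(* the scalar field, real or complex, as a numFieldType *)
Variant scalar_kind := RealScalars | ComplexScalars.

Section scalars.
Context (R : realType).

Definition scalar_field (k : scalar_kind) : numFieldType :=
  match k with RealScalars => R | ComplexScalars => R[i] end.

Definition sRe k : scalar_field k -> R :=
  match k with RealScalars => id | ComplexScalars => @complex.Re R end.

Definition sIm k : scalar_field k -> R :=
  match k with RealScalars => cst 0 | ComplexScalars => @complex.Im R end.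

(* the scalar with real part [a] and imaginary part [b]; over the reals, [b]
   is dropped *)
Definition sMk k : R -> R -> scalar_field k :=
  match k with RealScalars => fun a _ => a | ComplexScalars => @Complex R end.

Variable k : scalar_kind.
Local Notation F := (scalar_field k).

Lemma sReMk a b : sRe (sMk k a b) = a. Proof. by case: k. Qed.

Lemma sMkK (z : F) : sMk k (sRe z) (sIm z) = z.
Proof. by case: k z => //= -[]. Qed.

Lemma sImMk (z : F) a : sIm (sMk k a (sIm z)) = sIm z.
Proof. by case: k z. Qed.

Lemma sRe0 : sRe (0 : F) = 0. Proof. by case: k. Qed.
Lemma sIm0 : sIm (0 : F) = 0. Proof. by case: k. Qed.

Lemma sReD (x y : F) : sRe (x + y) = sRe x + sRe y.
Proof. by case: k x y => [//|[? ?] [? ?]]. Qed.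

Lemma sImD (x y : F) : sIm (x + y) = sIm x + sIm y.
Proof. by case: k x y => [? ?|[? ?] [? ?]]//=; rewrite /cst addr0. Qed.

Lemma sReN (x : F) : sRe (- x) = - sRe x.
Proof. by case: k x => [//|[? ?]]. Qed.

Lemma sImN (x : F) : sIm (- x) = - sIm x.
Proof. by case: k x => [?|[? ?]]//=; rewrite /cst oppr0. Qed.

Lemma sReM (x y : F) : sRe (x * y) = sRe x * sRe y - sIm x * sIm y.
Proof. by case: k x y => [? ?|[? ?] [? ?]]//=; rewrite /cst mul0r subr0. Qed.

Lemma sImM (x y : F) : sIm (x * y) = sRe x * sIm y + sIm x * sRe y.
Proof. by case: k x y => [? ?|[? ?] [? ?]]//=; rewrite /cst mul0r mulr0 addr0. Qed.

Lemma sext (x y : F) : sRe x = sRe y -> sIm x = sIm y -> x = y.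
Proof. by move=> re im; rewrite -(sMkK x) re im sMkK. Qed.

Lemma sMk_le (x y : F) : 0 <= x -> 0 <= y -> (x <= y) = (sRe x <= sRe y).
Proof.
case: k x y => [//|[a b] [c d]] /=.
by rewrite !lecE /= => /andP[/eqP -> _] /andP[/eqP -> _]; rewrite eqxx.
Qed.

End scalars.
Arguments sRe {R k}.
Arguments sIm {R k}.

Section norms.
Context (R : realType) (k : scalar_kind).
Local Notation F := (scalar_field R k).

(* the library norm of a normed space over [F] takes values in [F] *)
Definition rnorm (V : normedModType F) (v : V) : R := sRe `|v|.

End norms.

Section norm_lemmas.
Context (R : realType) (k : scalar_kind).
Local Notation F := (scalar_field R k).

Lemma rnorm_le (V W : normedModType F) (v : V) (w : W) :
  (`|v| <= `|w|) = (rnorm v <= rnorm w).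
Proof. by rewrite sMk_le. Qed.

Lemma rnorm_ge0 (V : normedModType F) (v : V) : 0 <= rnorm v.
Proof. by rewrite -(sRe0 R k) -sMk_le. Qed.

Lemma rnorm0 (V : normedModType F) : rnorm (0 : V) = 0.
Proof. by rewrite /rnorm normr0 sRe0. Qed.

Lemma ler_rnormD (V : normedModType F) (v w : V) :
  rnorm (v + w) <= rnorm v + rnorm w.
Proof. by rewrite /rnorm -sReD -sMk_le ?addr_ge0// ler_normD. Qed.

Lemma rnormZ (V : normedModType F) (a : F) (v : V) :
  rnorm (a *: v) = rnorm (a : F^o) * rnorm v.
Proof.
rewrite /rnorm normrZ sReM.
suff -> : sIm `|a| = 0 by rewrite mul0r subr0.
have : 0 <= `|a| by [].
by case: k a => [//|a]; rewrite lecE /= => /andP[/eqP].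
Qed.

Lemma rnorm_scalarE (z : F) : rnorm (z : F^o) = Num.sqrt (sRe z ^+ 2 + sIm z ^+ 2).
Proof.
case: k z => [a|[a b]] /=; first by rewrite /cst expr0n addr0 sqrtr_sqr.
by transitivity (complex.Re `|Complex a b|) => //; rewrite normc_def.
Qed.

Lemma ler_sRe_rnorm (z : F) : `|sRe z| <= rnorm (z : F^o).
Proof. by rewrite rnorm_scalarE -sqrtr_sqr ler_wsqrtr// lerDl sqr_ge0. Qed.

Lemma ler_sIm_rnorm (z : F) : `|sIm z| <= rnorm (z : F^o).
Proof. by rewrite rnorm_scalarE -sqrtr_sqr ler_wsqrtr// lerDr sqr_ge0. Qed.

Lemma ler_rnorm_sReIm (z : F) : rnorm (z : F^o) <= `|sRe z| + `|sIm z|.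
Proof.
rewrite rnorm_scalarE -[leRHS]ger0_norm ?addr_ge0// -sqrtr_sqr.
rewrite ler_wsqrtr// sqrrD !real_normK ?num_real//.
by rewrite addrAC lerDl mulrn_wge0// mulr_ge0.
Qed.

Lemma sMk_ge0E (x : F) : 0 <= x -> sMk k (sRe x) 0 = x.
Proof. by case: k x => [//|[a b]] /=; rewrite lecE /= => /andP[/eqP ->]. Qed.

Lemma sMk_lt (x : F) (e : R) : 0 <= x -> (x < sMk k e 0) = (sRe x < e).
Proof.
case: k x => [//|[a b]] /=.
by rewrite lecE ltcE /= => /andP[/eqP -> _]; rewrite eqxx.
Qed.

Lemma sMk_gt0 (e : R) : (0 < sMk k e 0) = (0 < e).
Proof. by rewrite sMk_lt// sRe0. Qed.

Lemma nbhs_rnormP (V : normedModType F) (v : V) (A : set V) :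
  nbhs v A <-> exists2 e : R, 0 < e & forall w, rnorm (v - w) < e -> A w.
Proof.
split=> [/nbhs_normP[e /= e0 eA]|[e e0 eA]].
  have eE : sMk k (sRe e) 0 = e by rewrite sMk_ge0E// ltW.
  exists (sRe e); first by rewrite -sMk_gt0 eE.
  by move=> w vw; apply: eA; rewrite /ball_/= -eE sMk_lt.
apply/nbhs_normP; exists (sMk k e 0); first by rewrite /= sMk_gt0.
by move=> w; rewrite /ball_/= sMk_lt// => /eA.
Qed.

Lemma rnorm_continuous_R (V : normedModType F) (f : V -> R) :
  (forall v w, `|f v - f w| <= rnorm (v - w)) -> continuous f.
Proof.
move=> fl v; apply/cvgrPdist_lt => e e0; apply/nbhs_rnormP; exists e => // w.
exact: le_lt_trans.
Qed.

Lemma rnorm_lipschitz_continuous (V W : normedModType F) (f : V -> W) (M : R) :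
  0 <= M -> (forall v w, rnorm (f v - f w) <= M * rnorm (v - w)) ->
  continuous f.
Proof.
move=> M0 fl v A /nbhs_rnormP[e e0 eA]; apply/nbhs_rnormP.
exists (e / (M + 1)) => [|w]; first by rewrite divr_gt0// ltr_wpDl.
rewrite ltr_pdivlMr ?ltr_wpDl// => vw; apply: eA; apply: le_lt_trans vw.
by rewrite (le_trans (fl v w))// mulrC ler_wpM2l ?rnorm_ge0// lerDl.
Qed.

Lemma sRe_continuous : continuous (@sRe R k).
Proof.
apply: (@rnorm_continuous_R F^o) => v w; rewrite -sReN -sReD.
exact: ler_sRe_rnorm.
Qed.

Lemma sIm_continuous : continuous (@sIm R k).
Proof.
apply: (@rnorm_continuous_R F^o) => v w; rewrite -sImN -sImD.
exact: ler_sIm_rnorm.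
Qed.

End norm_lemmas.

Section cdual.
Context (R : realType) (k : scalar_kind) (E : normedModType (scalar_field R k)).
Local Notation F := (scalar_field R k).

Definition dual_pred : {pred E -> F^o} :=
  [pred f : E -> F^o | `[< linear f /\ continuous f >]].

Lemma dual_pred_submod_closed : submod_closed dual_pred.
Proof.
split=> [|a f g]; rewrite !inE.
  split=> [a u v|]; first by rewrite /= scaler0 addr0.
  exact: cst_continuous.
move=> [lf cf] [lg cg]; split=> [b u v|].
  change (a *: f (b *: u + v) + g (b *: u + v) =
    b *: (a *: f u + g u) + (a *: f v + g v)).
  rewrite lf lg !scalerDr !scalerA (mulrC a b) -!addrA; congr (_ + _).
  by rewrite addrCA.
by move=> v; apply: cvgD; [apply: cvgZr; exact: cf|exact: cg].
Qed.

Record cdual := CDual { dual_fun :> E -> F^o ; _ : dual_fun \in dual_pred }.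

HB.instance Definition _ := [isSub for dual_fun].
HB.instance Definition _ := [Choice of cdual by <:].
HB.instance Definition _ := GRing.isSubmodClosed.Build _ _ dual_pred
  dual_pred_submod_closed.
HB.instance Definition _ := [SubChoice_isSubLmodule of cdual by <:].

(* operator norm *)
Definition dnorm (x : cdual) : R :=
  sup [set rnorm (x v) | v in [set v | rnorm v <= 1]].

Lemma dualP (x : cdual) : linear x /\ continuous x.
Proof. by have := valP x; rewrite inE. Qed.

HB.instance Definition _ (x : cdual) :=
  GRing.isLinear.Build F E F^o *:%R (dual_fun x) (dualP x).1.

Lemma dual_bounded (x : cdual) :
  exists2 M : R, 0 <= M & forall v, rnorm (x v) <= M * rnorm v.
Proof.
have /(_ 0) := (dualP x).2; rewrite /continuous_at linear0.
move=> /(_ [set z | rnorm (z : F^o) < 1]).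
have /[swap] /[apply] : nbhs (0 : F^o) [set z | rnorm (z : F^o) < 1].
  by apply/nbhs_rnormP; exists 1 => // w; rewrite sub0r /rnorm normrN.
move=> /nbhs_rnormP[e e0 /= ex]; exists (2 / e) => [|v].
  by rewrite divr_ge0// ltW.
have [v0|v0] := eqVneq (rnorm v) 0.
  have -> : v = 0.
    by apply/eqP; rewrite -normr_le0 -(normr0 E) rnorm_le v0 rnorm0.
  by rewrite linear0 !rnorm0 mulr0.
have {}v0 : 0 < rnorm v by rewrite lt_def v0 rnorm_ge0.
pose c := e / 2 / rnorm v.
have c0 : 0 < c by rewrite !divr_gt0.
have rc : rnorm (sMk k c 0 : F^o) = c.
  by rewrite /rnorm ger0_norm ?sReMk// ltW// sMk_gt0.
have ve : rnorm (0 - sMk k c 0 *: v) < e.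
  rewrite sub0r /rnorm normrN -/(rnorm _) rnormZ rc.
  by rewrite /c divfK ?gt_eqF// ltr_pdivrMr// ltr_pMr// ltr1n.
have /= := ex _ ve; rewrite linearZ/= rnormZ rc -ltr_pdivlMl// => /ltW/le_trans.
by apply; rewrite /c !invfM !invrK mulr1 [_^-1 * 2]mulrC.
Qed.

Lemma dnorm_has_sup (x : cdual) :
  has_sup [set rnorm (x v) | v in [set v | rnorm v <= 1]].
Proof.
split; first by exists (rnorm (x 0)), 0 => //=; rewrite rnorm0.
have [M M0 xM] := dual_bounded x; exists M => _ [v /= v1 <-].
by rewrite (le_trans (xM v))// -[leRHS]mulr1 ler_wpM2l.
Qed.

Lemma dnorm_ge0 (x : cdual) : 0 <= dnorm x.
Proof.
apply: (@le_trans _ _ (rnorm (x 0))); first exact: rnorm_ge0.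
apply: sup_upper_bound; first exact: dnorm_has_sup.
by exists 0 => //=; rewrite rnorm0.
Qed.

Lemma dnorm_ub (x : cdual) v : rnorm (x v) <= dnorm x * rnorm v.
Proof.
have [v0|v0] := eqVneq (rnorm v) 0.
  have -> : v = 0.
    by apply/eqP; rewrite -normr_le0 -(normr0 E) rnorm_le v0 rnorm0.
  by rewrite linear0 !rnorm0 mulr0.
have {}v0 : 0 < rnorm v by rewrite lt_def v0 rnorm_ge0.
have rc : rnorm (sMk k (rnorm v)^-1 0 : F^o) = (rnorm v)^-1.
  by rewrite /rnorm ger0_norm ?sReMk// ltW// sMk_gt0 invr_gt0.
rewrite -ler_pdivrMr// mulrC -{1}rc -rnormZ -linearZ.
apply: sup_upper_bound; first exact: dnorm_has_sup.
by exists (sMk k (rnorm v)^-1 0 *: v) => //=; rewrite rnormZ rc mulVf// gt_eqF.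
Qed.

Lemma dnorm_le (x : cdual) (M : R) : 0 <= M ->
  (forall v, rnorm (x v) <= M * rnorm v) -> dnorm x <= M.
Proof.
move=> M0 xM; apply: ge_sup.
  by exists (rnorm (x 0)), 0 => //=; rewrite rnorm0.
move=> _ [v /= v1 <-]; rewrite (le_trans (xM v))//.
by rewrite -[leRHS]mulr1 ler_wpM2l.
Qed.

Lemma dnorm0 : dnorm 0 <= 1.
Proof. by apply: dnorm_le => // v; rewrite rnorm0 mul1r rnorm_ge0. Qed.

Definition dual_ball := {x : cdual | dnorm x <= 1}.

(* the initial topology of the evaluations at the points of [E] *)
Definition weak_star_ball := initial_topology
  (fun x : dual_ball => (fun v => sval x v) : {ptws E -> F^o}).
HB.instance Definition _ := Topological.on weak_star_ball.
HB.instance Definition _ := isPointed.Build weak_star_ball (exist _ 0 dnorm0).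

End cdual.


Notation Borel T := (g_sigma_algebraType (@open T)).

Section borel.
Context (R : realType) (T : ptopologicalType).

Lemma open_borel (A : set T) : open A -> measurable (A : set (Borel T)).
Proof. exact: sub_sigma_algebra. Qed.

Lemma closed_borel (A : set T) : closed A -> measurable (A : set (Borel T)).
Proof.
move=> cA; rewrite -[A]setCK; apply: measurableC.
by apply: open_borel; exact: closed_openC.
Qed.

Lemma continuous_borel (U : ptopologicalType) (f : T -> U) (A : set (Borel U)) :
  continuous f -> measurable A -> measurable (f @^-1` A : set (Borel T)).
Proof.
move=> /continuousP cf mA; rewrite -[X in measurable X]setTI.
have := @measurability _ _ (Borel T) (Borel U) setT f open.
apply => // _ [B oB <-]; rewrite setTI.
by apply: open_borel; exact: cf.
Qed.

Lemma continuous_measurable_borel (f : T -> R) :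
  continuous f -> measurable_fun setT (f : Borel T -> R).
Proof.
move=> /continuousP cf; apply: (measurability _ (RGenOpens.measurableE R)).
move=> _ [_ [a [b ->] <-]]; rewrite setTI; apply: open_borel.
exact/cf/interval_open.
Qed.

(* library measures are functions on all sets, constrained only on measurable
   ones, so that equality of measures is equality on Borel sets *)
Definition borel_eq (V : Type) (m1 m2 : set (Borel T) -> V) :=
  forall A : set (Borel T), measurable A -> m1 A = m2 A.

(* supremum of [nrm (m P_0) + ... + nrm (m P_(n-1))] over the finite Borel
   partitions of [A] *)
Definition borel_variation (V : Type) (nrm : V -> \bar R) (m : set (Borel T) -> V)
    (A : set (Borel T)) : \bar R :=
  ereal_sup [set s | exists n (P : 'I_n -> set (Borel T)),
    [/\ forall i, measurable (P i), trivIset setT P, \bigcup_i P i = A &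
        s = (\sum_(i < n) nrm (m (P i)))%E]].

Definition borel_regular (m : set (Borel T) -> \bar R) :=
  forall A : set (Borel T), measurable A ->
    forall e : R, 0 < e -> exists C U : set T,
    [/\ compact C, open U, C `<=` A, A `<=` U & (m (U `\` C) <= e%:E)%E].

Record radon_measure := RadonMeasure {
  radon_fun :> {finite_measure set (Borel T) -> \bar R} ;
  _ : borel_regular radon_fun }.

(* choice and a default value, for [batty_W] *)
HB.instance Definition _ := gen_eqMixin radon_measure.
HB.instance Definition _ := gen_choiceMixin radon_measure.

Lemma mzero_regular : borel_regular (@mzero _ (Borel T) R).
Proof.
move=> A mA e e0; exists set0, setT; split => //; first exact: compact0.
- exact: openT.
- by rewrite /mzero/= lee_fin ltW.
Qed.

HB.instance Definition _ := isPointed.Build radon_measure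
  (RadonMeasure mzero_regular).

Definition radon_norm (nu : radon_measure) : \bar R := borel_variation abse nu setT.

End borel.

Section scalar_integral_def.
Context (R : realType) (k : scalar_kind) d (T : measurableType d).
Local Notation F := (scalar_field R k).
Variable nu : {measure set T -> \bar R}.

Definition scalar_integral (D : set T) (h : T -> F) : F :=
  sMk k (\int[nu]_(x in D) sRe (h x)) (\int[nu]_(x in D) sIm (h x)).

End scalar_integral_def.

Section scalar_integral_lemmas.
Context (R : realType) (k : scalar_kind) d (T : measurableType d).
Local Notation F := (scalar_field R k).
Variable nu : {finite_measure set T -> \bar R}.
Implicit Types (D : set T) (h : T -> F).

Definition sbounded h := [/\ measurable_fun setT (fun x => sRe (h x)),
  measurable_fun setT (fun x => sIm (h x)) &
  exists M : R, forall x, rnorm (h x : F^o) <= M].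

Lemma sbounded_integrable D h : measurable D -> sbounded h ->
  nu.-integrable D (EFin \o (fun x => sRe (h x))) /\
  nu.-integrable D (EFin \o (fun x => sIm (h x))).
Proof.
move=> mD [mre mim [M hM]].
have bnd (f : T -> R) : (forall x, `|f x| <= rnorm (h x : F^o)) ->
    [bounded f x | x in D].
  move=> fh; exists M; split; rewrite ?num_real// => r Mr x _ /=.
  by rewrite (le_trans (fh x))// (le_trans (hM x))// ltW.
split; apply: measurable_bounded_integrable => //.
- by rewrite ltey_eq fin_num_measure.
- exact: measurable_funTS.
- by apply: bnd => x; exact: ler_sRe_rnorm.
- by rewrite ltey_eq fin_num_measure.
- exact: measurable_funTS.
- by apply: bnd => x; exact: ler_sIm_rnorm.
Qed.

Lemma sRe_scalar_integral D h : sRe (scalar_integral nu D h) = \int[nu]_(x in D) sRe (h x).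
Proof. by rewrite sReMk. Qed.

Lemma sIm_scalar_integral D h : sIm (scalar_integral nu D h) = \int[nu]_(x in D) sIm (h x).
Proof.
rewrite /scalar_integral; case: k h => //= h.
by rewrite /Rintegral integral0.
Qed.

Lemma scalar_integral_linear D (a : F) h g : measurable D ->
  sbounded h -> sbounded g ->
  scalar_integral nu D (fun x => a * h x + g x) =
  a * scalar_integral nu D h + scalar_integral nu D g.
Proof.
move=> mD /(sbounded_integrable mD)[h1 h2] /(sbounded_integrable mD)[g1 g2].
have Z (f : T -> R) c : nu.-integrable D (EFin \o f) ->
    nu.-integrable D (EFin \o (fun x => c * f x)).
  move=> fi; have -> : EFin \o (fun x => c * f x) = (fun x => c%:E * (f x)%:E)%E.
    by [].
  exact: integrableZl.
have A (f f' : T -> R) :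
    nu.-integrable D (EFin \o f) -> nu.-integrable D (EFin \o f') ->
    nu.-integrable D (EFin \o (fun x => f x + f' x)).
  move=> ? ?.
  have -> : EFin \o (fun x => f x + f' x) = ((EFin \o f) \+ (EFin \o f'))%E.
    by [].
  exact: integrableD.
apply: sext.
- rewrite sReD sReM !sRe_scalar_integral sIm_scalar_integral.
  under eq_Rintegral do rewrite sReD sReM -mulNr.
  by rewrite !RintegralD ?RintegralZl ?mulNr//; do ?apply: A; do ?apply: Z.
- rewrite sImD sImM !sIm_scalar_integral sRe_scalar_integral.
  under eq_Rintegral do rewrite sImD sImM.
  by rewrite !RintegralD ?RintegralZl//; do ?apply: A; do ?apply: Z.
Qed.

Lemma scalar_integral_bound D h (M : R) : measurable D -> sbounded h ->
  (forall x, D x -> rnorm (h x : F^o) <= M) ->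
  rnorm (scalar_integral nu D h : F^o) <= 2 * (M * fine (nu D)).
Proof.
move=> mD bh hM; have [h1 h2] := sbounded_integrable mD bh.
have B (f : T -> R) : (forall x, `|f x| <= rnorm (h x : F^o)) ->
    nu.-integrable D (EFin \o f) ->
    `|\int[nu]_(x in D) f x| <= M * fine (nu D).
  move=> fh fi; rewrite (le_trans (le_normr_Rintegral _ fi))//.
  rewrite -Rintegral_cst//; apply: le_Rintegral => //.
  - exact: integrable_norm.
  - by apply: finite_measure_integrable_cst.
  - by move=> x Dx; rewrite (le_trans (fh x))// hM.
rewrite (le_trans (ler_rnorm_sReIm _))// mulr_natl mulr2n lerD//.
- by rewrite sRe_scalar_integral B// => x; exact: ler_sRe_rnorm.
- by rewrite sIm_scalar_integral B// => x; exact: ler_sIm_rnorm.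
Qed.

Lemma scalar_integralU D1 D2 h : measurable D1 -> measurable D2 -> sbounded h ->
  D1 `&` D2 = set0 ->
  scalar_integral nu (D1 `|` D2) h = scalar_integral nu D1 h + scalar_integral nu D2 h.
Proof.
move=> m1 m2 bh D12.
have [h1 h2] := sbounded_integrable (measurableU _ _ m1 m2) bh.
have dD : [disjoint D1 & D2] by apply/disj_setPS; rewrite D12.
by apply: sext; rewrite ?(sReD, sImD) ?sRe_scalar_integral ?sIm_scalar_integral Rintegral_setU.
Qed.

End scalar_integral_lemmas.

Section vector_measures.
Context (R : realType) (k : scalar_kind) (K : ptopologicalType)
  (E : normedModType (scalar_field R k)).
Local Notation F := (scalar_field R k).

Definition countably_additive (m : set (Borel K) -> cdual E) :=
  forall A : (set (Borel K))^nat, (forall i, measurable (A i)) ->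
    trivIset setT A ->
    dnorm (m (\bigcup_i A i) - \sum_(i < n) m (A i)) @[n --> \oo] --> (0 : R).

Definition cdual_variation (m : set (Borel K) -> cdual E) : set (Borel K) -> \bar R :=
  borel_variation (fun x : cdual E => (dnorm x)%:E) m.

(* the values outside the Borel sets are irrelevant; see [borel_eq] *)
Record vmeasure := VMeasure {
  vmeasure_fun :> set (Borel K) -> cdual E ;
  _ : countably_additive vmeasure_fun ;
  _ : borel_regular (cdual_variation vmeasure_fun) ;
  _ : (cdual_variation vmeasure_fun setT < +oo)%E }.

Definition vmeasure_norm (mu : vmeasure) : \bar R := cdual_variation mu setT.

Record borel_step := Step {
  step_size : nat ;
  step_set : 'I_step_size -> set (Borel K) ;
  step_val : 'I_step_size -> E ;
  _ : forall j, measurable (step_set j) }.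

Definition step_fun (s : borel_step) (t : K) : E :=
  \sum_(j < step_size s) (\1_(step_set j) t : F) *: step_val j.

Definition step_int (mu : vmeasure) (s : borel_step) : F^o :=
  \sum_(j < step_size s) mu (step_set j) (step_val j).

(* the filter of step functions tending uniformly to [g] *)
Definition unif_step (g : K -> E) : set_system borel_step :=
  filter_from [set e : R | 0 < e]
    (fun e => [set s | forall t, rnorm (g t - step_fun s t) < e]).

Definition vint (mu : vmeasure) (g : K -> E) : F :=
  lim (step_int mu s @[s --> unif_step g]).

End vector_measures.

HB.instance Definition _ (T U : ptopologicalType) := Pointed.on (T * U)%type.

Section adjoint.
Context (R : realType) (k : scalar_kind) (K : ptopologicalType)
  (E : normedModType (scalar_field R k)).
Local Notation F := (scalar_field R k).
Local Notation KB := (K * weak_star_ball E)%type.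

Lemma dual_eval_continuous (v : E) : continuous (fun z : KB => sval z.2 v : F^o).
Proof.
move=> z.
apply: (@continuous_comp KB (weak_star_ball E) F^o snd (fun x => sval x v)).
  exact: cvg_snd.
apply: (@continuous_comp (weak_star_ball E) {ptws E -> F^o} F^o
  (fun x v => sval x v) (@^~ v)).
  exact: initial_continuous.
exact: proj_continuous.
Qed.

Lemma dual_eval_sbounded (v : E) :
  sbounded (fun z : Borel KB => sval z.2 v : F).
Proof.
split.
- apply: continuous_measurable_borel => z.
  apply: (@continuous_comp KB F^o R (fun z => sval z.2 v) sRe).
    exact: dual_eval_continuous.
  exact: sRe_continuous.
- apply: continuous_measurable_borel => z.
  apply: (@continuous_comp KB F^o R (fun z => sval z.2 v) sIm).
    exact: dual_eval_continuous.
  exact: sIm_continuous.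
- exists (rnorm v) => z; rewrite (le_trans (dnorm_ub _ _))//.
  by rewrite -[leRHS]mul1r ler_wpM2r// ?rnorm_ge0//; exact: (svalP z.2).
Qed.

Lemma cylE (A : set (Borel K)) :
  (A `*` setT : set (Borel KB)) = (fun z : KB => z.1) @^-1` A.
Proof. by apply/seteqP; split=> [z []|z]. Qed.

Lemma measurable_cylinder (A : set (Borel K)) : measurable A ->
  measurable (A `*` setT : set (Borel KB)).
Proof.
move=> mA; rewrite cylE.
by apply: (@continuous_borel KB K fst) => // z; exact: cvg_fst.
Qed.

Lemma KB_hausdorff : hausdorff_space K -> hausdorff_space KB.
Proof.
move=> hK.
have sep (L : topologicalType) (f : KB -> L) p q : continuous f ->
    hausdorff_space L -> cluster (nbhs p) q -> f p = f q.
  move=> cf hL pq; apply: hL => A B /cf fA /cf fB.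
  by have [z [? ?]] := pq _ _ fA fB; exists (f z).
move=> [p1 p2] [q1 q2] pq; congr (_, _).
  by apply: (sep K fst (p1, p2) (q1, q2)) => // z; exact: cvg_fst.
apply/val_inj/val_inj/funext => v.
apply: (sep F^o (fun z => sval z.2 v) (p1, p2) (q1, q2)) => //.
exact: dual_eval_continuous.
Qed.

Definition Tadj_val (nu : radon_measure R KB) (A : set (Borel K)) : E -> F^o :=
  fun v => scalar_integral nu (A `*` setT) (fun z : Borel KB => sval z.2 v).

Lemma Tadj_val_bound nu A v : measurable A ->
  rnorm (Tadj_val nu A v) <= 2 * fine (nu (A `*` setT)) * rnorm v.
Proof.
move=> mA; rewrite -mulrA [_ * rnorm v]mulrC.
apply: scalar_integral_bound => //; first exact: measurable_cylinder.
  exact: dual_eval_sbounded.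
move=> z _; rewrite (le_trans (dnorm_ub _ _))//.
by rewrite -[leRHS]mul1r ler_wpM2r// ?rnorm_ge0//; exact: (svalP z.2).
Qed.

Lemma Tadj_val_dual nu A : measurable A -> Tadj_val nu A \in @dual_pred R k E.
Proof.
move=> mA; rewrite inE.
have lT : linear (Tadj_val nu A).
  move=> a u v; rewrite /Tadj_val -[RHS]scalar_integral_linear.
  - by congr scalar_integral; apply/funext => z; rewrite linearP.
  - exact: measurable_cylinder.
  - exact: dual_eval_sbounded.
  - exact: dual_eval_sbounded.
split=> //; apply: (@rnorm_lipschitz_continuous _ _ _ _ _
  (2 * fine (nu (A `*` setT)))) => [|u v].
  by rewrite mulr_ge0// fine_ge0.
have -> : Tadj_val nu A u - Tadj_val nu A v = Tadj_val nu A (u - v).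
  have -> : u - v = -1 *: v + u by rewrite scaleN1r addrC.
  by rewrite lT scaleN1r addrC.
exact: Tadj_val_bound.
Qed.

(* [Tadj_val nu A] is a continuous functional for Borel [A] (Tadj_val_dual);
   other sets get a junk value *)
Definition Tadj_fun (nu : radon_measure R KB) (A : set (Borel K)) : cdual E :=
  insubd 0 (Tadj_val nu A).

Lemma Tadj_funE nu A v : measurable A -> Tadj_fun nu A v = Tadj_val nu A v.
Proof. by move=> mA; rewrite [dual_fun _]insubdK//; exact: Tadj_val_dual. Qed.

Lemma dnorm_Tadj nu A : measurable A ->
  dnorm (Tadj_fun nu A) <= 2 * fine (nu (A `*` setT)).
Proof.
move=> mA; apply: dnorm_le => [|v]; first by rewrite mulr_ge0// fine_ge0.
by rewrite Tadj_funE// Tadj_val_bound.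
Qed.

Lemma Tadj_funU nu A B : measurable A -> measurable B -> A `&` B = set0 ->
  Tadj_fun nu (A `|` B) = Tadj_fun nu A + Tadj_fun nu B.
Proof.
move=> mA mB AB; apply/val_inj/funext => v /=.
rewrite [LHS]Tadj_funE ?[RHS]/=; last exact: measurableU.
rewrite [RHS](_ : _ = Tadj_fun nu A v + Tadj_fun nu B v)// !Tadj_funE//.
rewrite /Tadj_val -scalar_integralU.
- by congr scalar_integral; rewrite !cylE preimage_setU.
- exact: measurable_cylinder.
- exact: measurable_cylinder.
- exact: dual_eval_sbounded.
- by rewrite -setXI AB set0X.
Qed.

Lemma Tadj_fun0 nu : Tadj_fun nu set0 = 0.
Proof.
have := @Tadj_funU nu set0 set0 measurable0 measurable0 (set0I _).
by rewrite setU0 => /eqP; rewrite -[X in X == _]addr0 => /eqP/addrI.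
Qed.

Lemma Tadj_fun_sum nu (A : (set (Borel K))^nat) n :
  (forall i, measurable (A i)) -> trivIset setT A ->
  Tadj_fun nu (\big[setU/set0]_(i < n) A i) = \sum_(i < n) Tadj_fun nu (A i).
Proof.
move=> mA tA; elim: n => [|n ih]; first by rewrite !big_ord0 Tadj_fun0.
rewrite !big_ord_recr/= -ih Tadj_funU//.
  by apply: bigsetU_measurable => i _; exact: mA.
rewrite (@trivIset_bigsetUI _ xpredT)//.
by rewrite [X in trivIset X A](_ : _ = [set: nat])//; exact/seteqP.
Qed.

Lemma Tadj_countably_additive nu : countably_additive (Tadj_fun nu).
Proof.
move=> A mA tA; pose tl n := \bigcup_i A i `\` \big[setU/set0]_(i < n) A i.
have mU : measurable (\bigcup_i A i) by exact: bigcupT_measurable.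
have mb n : measurable (\big[setU/set0]_(i < n) A i).
  exact: bigsetU_measurable.
have mt n : measurable (tl n) by exact: measurableD.
have sub n : \big[setU/set0]_(i < n) A i `<=` \bigcup_i A i.
  exact: bigsetU_bigcup.
have -> : (fun n => dnorm (Tadj_fun nu (\bigcup_i A i) -
    \sum_(i < n) Tadj_fun nu (A i))) = (fun n => dnorm (Tadj_fun nu (tl n))).
  apply/funext => n; congr dnorm; apply/eqP; rewrite subr_eq; apply/eqP.
  rewrite -Tadj_fun_sum// -Tadj_funU//; last by rewrite setDKI.
  by rewrite setUC setDUK.
have cap0 : \bigcap_n (tl n `*` setT) = set0 :> set (Borel KB).
  apply/seteqP; split => // z zt.
  have [[[i _ Ai] _] _] := zt 0%N I.
  have [[_ zN] _] := zt i.+1 I.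
  by apply: zN; rewrite big_ord_recr/=; right.
have cvg_tl : nu (tl n `*` setT) @[n --> \oo] --> 0%E.
  rewrite -(measure0 nu) -cap0; apply: nonincreasing_cvg_mu.
  - by rewrite ltey_eq fin_num_measure//; exact: measurable_cylinder.
  - by move=> n; exact: measurable_cylinder.
  - by apply: bigcapT_measurable => n; exact: measurable_cylinder.
  - move=> m n mn; apply/subsetPset => z [[zU zN] _]; split => //; split => //.
    by apply: contra_not zN; exact: subset_bigsetU.
have cvg0 : fine (nu (tl n `*` setT)) @[n --> \oo] --> (0 : R).
  exact: fine_cvg.
apply: (@squeeze_cvgr _ _ _ _ (cst 0) (fun n => 2 * fine (nu (tl n `*` setT)))).
- by apply: nearW => n; rewrite /= dnorm_ge0 dnorm_Tadj.
- exact: cvg_cst.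
- by rewrite -[0](mulr0 2); exact: cvgMl_tmp.
Qed.

Lemma bigcupT_ord (T : Type) n (P : 'I_n -> set T) :
  \bigcup_i P i = \big[setU/set0]_(i < n) P i.
Proof.
rewrite -bigcup_seq; apply: eq_bigcupl; split=> i //= _.
exact: mem_index_enum.
Qed.

Lemma variation_Tadj nu (A : set (Borel K)) : measurable A ->
  (cdual_variation (Tadj_fun nu) A <= 2%:E * nu (A `*` setT))%E.
Proof.
move=> mA; apply: ge_ereal_sup => _ [n [P [mP tP PA ->]]].
have -> : nu (A `*` setT) = (\sum_(i < n) nu (P i `*` setT))%E.
  rewrite -measure_bigsetU_ord.
  - by rewrite -bigcupT_ord -PA cylE preimage_bigcup; under eq_bigcupr do rewrite -cylE.
  - by move=> i; exact: measurable_cylinder.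
  - by move=> i j _ _ [z [[? _] [? _]]]; apply: tP => //; exists z.1.
rewrite ge0_sume_distrr//; apply: lee_sum => i _.
rewrite -[nu _]fineK ?fin_num_measure//; last exact: measurable_cylinder.
by rewrite -EFinM lee_fin dnorm_Tadj.
Qed.

Lemma Tadj_regular nu : hausdorff_space K ->
  borel_regular (cdual_variation (Tadj_fun nu)).
Proof.
move=> hK.
have inner (A : set (Borel K)) e : measurable A -> 0 < e ->
    exists C : set K, [/\ compact C, C `<=` A &
    (nu ((A `\` C) `*` setT) <= e%:E)%E].
  move=> mA e0; have mcA := measurable_cylinder mA.
  have : borel_regular nu by case: nu.
  move=> /(_ _ mcA _ e0)[C [U [cC oU CA AU nuUC]]].
  exists (fst @` C); split.
  - apply: continuous_compact => //.
    by apply: continuous_subspaceT => z; exact: cvg_fst.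
  - by move=> _ [z /CA[? _] <-].
  - have cF : closed (fst @` C).
      apply: compact_closed => //; apply: continuous_compact => //.
      by apply: continuous_subspaceT => z; exact: cvg_fst.
    apply: le_trans nuUC; apply: le_measure; rewrite ?inE.
    + by apply: measurable_cylinder; apply: measurableD => //; exact: closed_borel.
    + apply: measurableD; first exact: open_borel.
      by apply: closed_borel; apply: compact_closed => //; exact: KB_hausdorff.
    + move=> z [[zA zC] _]; split; first exact: AU.
      by move=> Cz; apply: zC; exists z.
move=> A mA e e0.
have e4 : 0 < e / 4 by rewrite divr_gt0.
have [C [cC CA nuC]] := inner A _ mA e4.
have [D [cD DA nuD]] := inner (~` A) _ (measurableC mA) e4.
have clC := compact_closed hK cC; have clD := compact_closed hK cD.
exists C, (~` D); split => //; first exact: closed_openC.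
  by rewrite -[A]setCK; exact: subsetC.
have mC : measurable (C : set (Borel K)) by exact: closed_borel.
have mD : measurable (D : set (Borel K)) by exact: closed_borel.
apply: le_trans (variation_Tadj _ _) _; first by apply: measurableD => //; exact: measurableC.
have m1 : measurable ((A `\` C) `*` setT : set (Borel KB)).
  by apply: measurable_cylinder; exact: measurableD.
have m2 : measurable ((~` A `\` D) `*` setT : set (Borel KB)).
  by apply: measurable_cylinder; apply: measurableD => //; exact: measurableC.
apply: (@le_trans _ _ (2%:E * (nu ((A `\` C) `*` setT) +
    nu ((~` A `\` D) `*` setT)))%E).
  rewrite lee_pmul2l//.
  apply: le_trans (measureU2 _ m1 m2); apply: le_measure; rewrite ?inE.
  - by apply: measurable_cylinder; apply: measurableD => //; exact: measurableC.
  - exact: measurableU.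
  - move=> z [[zD zC] _]; have [zA|zA] := pselect (A z.1).
      by left.
    by right.
apply: (@le_trans _ _ (2%:E * ((e / 4)%:E + (e / 4)%:E))%E).
  by rewrite lee_pmul2l// leeD.
by rewrite -EFinD -EFinM lee_fin; lra.
Qed.

Lemma Tadj_bounded_variation nu :
  (cdual_variation (Tadj_fun nu) setT < +oo)%E.
Proof.
apply: le_lt_trans (variation_Tadj _ measurableT) _.
rewrite -[nu _]fineK ?fin_num_measure//; last exact: measurable_cylinder.
by rewrite -EFinM ltry.
Qed.

Definition Tadj (hK : hausdorff_space K) (nu : radon_measure R KB) :
    vmeasure K E :=
  VMeasure (Tadj_countably_additive nu) (Tadj_regular nu hK)
    (Tadj_bounded_variation nu).

End adjoint.

Section adjoint_correct.
Context (R : realType) (k : scalar_kind) (K : ptopologicalType)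
  (E : normedModType (scalar_field R k)).
Local Notation F := (scalar_field R k).
Local Notation KB := (K * weak_star_ball E)%type.

Definition T_op (g : K -> E) (z : KB) : F := sval z.2 (g z.1).

Lemma T_op_continuous (g : K -> E) : continuous g ->
  continuous (T_op g : KB -> F^o).
Proof.
move=> cg [t0 x0] A /= /nbhs_rnormP[e e0 eA].
have e2 : 0 < e / 2 by rewrite divr_gt0.
have N1 : \forall z \near (t0, x0), rnorm (g t0 - g (z : KB).1) < e / 2.
  have : nbhs (t0, x0) ((fun z : KB => g z.1) @^-1`
      [set v | rnorm (g t0 - v) < e / 2]).
    apply: (@continuous_comp KB K E fst g); [exact: cvg_fst|exact: cg|].
    by apply/nbhs_rnormP; exists (e / 2).
  by [].
have N2 : \forall z \near (t0, x0),
    rnorm (sval x0 (g t0) - sval (z : KB).2 (g t0)) < e / 2.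
  have cev : continuous (fun z : KB => sval z.2 (g t0) : F^o).
    exact: dual_eval_continuous.
  have := cev (t0, x0).
  move=> /(_ [set v | rnorm (sval x0 (g t0) - v) < e / 2]); apply.
  by apply/nbhs_rnormP; exists (e / 2).
change (\forall z \near (t0, x0), A (T_op g z)).
near=> z; apply: eA.
have -> : T_op g (t0, x0) - T_op g z = (sval x0 (g t0) - sval z.2 (g t0)) +
    sval z.2 (g t0 - g z.1).
  by rewrite /T_op /= linearB/= addrA subrK.
rewrite (le_lt_trans (ler_rnormD _ _))// [ltRHS]splitr ltrD//.
  by near: z.
apply: (@le_lt_trans _ _ (rnorm (g t0 - g z.1))); last by near: z.
rewrite (le_trans (dnorm_ub _ _))//.
by rewrite -[leRHS]mul1r ler_wpM2r// ?rnorm_ge0//; exact: (svalP z.2).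
Unshelve. all: by end_near. Qed.

Lemma T_op_sbounded (g : K -> E) (M : R) :
  measurable_fun setT (fun z : Borel KB => sRe (T_op g z)) ->
  measurable_fun setT (fun z : Borel KB => sIm (T_op g z)) ->
  (forall t, rnorm (g t) <= M) -> sbounded (T_op g : Borel KB -> F).
Proof.
move=> mre mim gM; split => //; exists M => z; rewrite (le_trans (dnorm_ub _ _))//.
rewrite (le_trans _ (gM z.1))// -[leRHS]mul1r ler_wpM2r// ?rnorm_ge0//.
exact: (svalP z.2).
Qed.

Lemma T_op_continuous_sbounded (g : K -> E) : compact [set: K] ->
  continuous g -> sbounded (T_op g : Borel KB -> F).
Proof.
move=> cK cg.
have cn : continuous (fun t => rnorm (g t)).
  move=> t; apply: (@continuous_comp K E R g (@rnorm R k E)); first exact: cg.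
  apply: rnorm_continuous_R => v w; rewrite ler_norml; apply/andP; split.
    rewrite lerNl opprB lerBlDr -{1}(subrK v w) (le_trans (ler_rnormD _ _))//.
    by rewrite lerD2r /rnorm distrC.
  by rewrite lerBlDr -{1}(subrK w v) ler_rnormD.
have /compact_bounded[M [_ gM]] : compact [set rnorm (g t) | t in [set: K]].
  by apply: continuous_compact => //; exact: continuous_subspaceT.
apply: (@T_op_sbounded _ (M + 1)).
- apply: continuous_measurable_borel => z.
  apply: (@continuous_comp KB F^o R (T_op g) sRe); last exact: sRe_continuous.
  exact: T_op_continuous.
- apply: continuous_measurable_borel => z.
  apply: (@continuous_comp KB F^o R (T_op g) sIm); last exact: sIm_continuous.
  exact: T_op_continuous.
- move=> t; rewrite (le_trans (ler_norm _))// gM// ltrDl//.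
Qed.

Lemma T_op_step (s : borel_step K E) (z : KB) : T_op (step_fun s) z =
  \sum_(j < step_size s) (\1_(step_set j `*` setT) z : F) * sval z.2 (step_val j).
Proof.
rewrite /T_op /step_fun linear_sum; apply: eq_bigr => j _.
by rewrite linearZ/= !indicE in_setX in_setT andbT.
Qed.

Lemma indic_sbounded (A : set (Borel K)) (v : E) : measurable A ->
  sbounded (fun z : Borel KB => (\1_(A `*` setT) z : F) * sval z.2 v).
Proof.
move=> mA; have [mre mim [M hM]] := @dual_eval_sbounded R k K E v.
have reE (z : KB) : sRe ((\1_(A `*` setT) z : F) * sval z.2 v) =
    \1_(A `*` setT) z * sRe (sval z.2 v : F).
  by rewrite !indicE; case: (_ \in _); rewrite ?mul1r// !mul0r sRe0.
have imE (z : KB) : sIm ((\1_(A `*` setT) z : F) * sval z.2 v) =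
    \1_(A `*` setT) z * sIm (sval z.2 v : F).
  by rewrite !indicE; case: (_ \in _); rewrite ?mul1r// !mul0r sIm0.
split.
- under eq_fun do rewrite reE.
  by apply: measurable_funM => //; apply: measurable_indic; exact: measurable_cylinder.
- under eq_fun do rewrite imE.
  by apply: measurable_funM => //; apply: measurable_indic; exact: measurable_cylinder.
- exists M => z; rewrite indicE; case: (_ \in _); rewrite ?mul1r//.
  by rewrite mul0r rnorm0 (le_trans _ (hM z))// rnorm_ge0.
Qed.

Lemma scalar_integral_indic (nu : radon_measure R KB) (A : set (Borel K)) (v : E) :
  measurable A ->
  scalar_integral nu setT (fun z : Borel KB => (\1_(A `*` setT) z : F) * sval z.2 v) =
  Tadj_fun nu A v.
Proof.
move=> mA; rewrite Tadj_funE// /Tadj_val /scalar_integral.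
rewrite [in RHS]Rintegral_mkcond [X in _ = sMk k _ X]Rintegral_mkcond.
by congr sMk; apply: eq_Rintegral => z _; rewrite patchE indicE;
  case: (_ \in _); rewrite ?mul1r// mul0r ?sRe0 ?sIm0.
Qed.

Lemma step_int_Tadj (nu : radon_measure R KB) hK (s : borel_step K E) :
  sbounded (T_op (step_fun s) : Borel KB -> F) /\
  step_int (Tadj hK nu) s = scalar_integral nu setT (T_op (step_fun s)).
Proof.
have -> : T_op (step_fun s) = (fun z => \sum_(j < step_size s)
    (\1_(step_set j `*` setT) z : F) * sval z.2 (step_val j)).
  by apply/funext => z; exact: T_op_step.
rewrite /step_int; case: s => n A v /= mA.
elim: n A v mA => [|n ih] A v mA.
  rewrite big_ord0; under eq_fun do rewrite big_ord0.
  split.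
    split; rewrite ?sRe0 ?sIm0; try exact: measurable_cst.
    by exists 0 => z; rewrite rnorm0.
  by apply: sext; rewrite ?sRe_scalar_integral ?sIm_scalar_integral ?(sRe0, sIm0)
    /Rintegral integral0.
have [bs e] := ih _ (fun j => v (lift ord0 j)) (fun j => mA (lift ord0 j)).
have b0 := indic_sbounded (v ord0) (mA ord0).
pose h0 (z : Borel KB) : F := \1_(A ord0 `*` setT) z * sval z.2 (v ord0).
pose hs (z : Borel KB) : F := \sum_(j < n)
  (\1_(A (lift ord0 j) `*` setT) z : F) * sval z.2 (v (lift ord0 j)).
rewrite big_ord_recl (_ : (fun z : KB => _) = (fun z => 1 * h0 z + hs z)).
  rewrite scalar_integral_linear// mul1r e [in RHS]scalar_integral_indic//.
  split => //; have [mre mim [M hM]] := bs; have [mre' mim' [M' hM']] := b0.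
  split.
  - under eq_fun do rewrite mul1r sReD.
    exact: measurable_funD.
  - under eq_fun do rewrite mul1r sImD.
    exact: measurable_funD.
  - exists (M' + M) => z; rewrite mul1r (le_trans (ler_rnormD _ _))// lerD//.
      exact: hM'.
    exact: hM.
by apply/funext => z; rewrite big_ord_recl mul1r.
Qed.

Lemma unif_step_proper (g : K -> E) : compact [set: K] -> continuous g ->
  ProperFilter (unif_step g).
Proof.
move=> cK cg; apply: filter_from_proper; last first.
  move=> e /= e0.
  pose O (u : K) := g @^-1` [set v | rnorm (v - g u) < e].
  have oO u : open (O u).
    apply: open_comp => [t _|]; first exact: cg.
    rewrite openE => v /= ve; apply/nbhs_rnormP.
    exists (e - rnorm (v - g u)); first by rewrite subr_gt0.
    move=> w vw; rewrite /= -(subrK v w) -addrA (le_lt_trans (ler_rnormD _ _))//.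
    by rewrite -ltrBrDr /rnorm distrC.
  move: cK; rewrite compact_cover => /(_ K setT O (fun u _ => oO u)).
  case=> [t _|D _ cD]; first by exists t => //=; rewrite /O/= subrr rnorm0.
  pose s : seq K := finmap.enum_fset D; pose G i := O (nth point s i).
  have mG i : measurable (G i : set (Borel K)) by exact: (open_borel (oO (nth point s i))).
  have mA (j : 'I_(size s)) : measurable (seqDU G j : set (Borel K)).
    exact: seqDU_measurable.
  exists (Step (fun j => g (nth point s j)) mA) => t /=.
  have [u /= uD Ou] := cD t I.
  have : (\big[setU/set0]_(i < size s) G i) t.
    rewrite -bigcup_mkord; exists (index u s) => /=; first by rewrite index_mem.
    by rewrite /G nth_index.
  rewrite bigsetU_seqDU -bigcup_mkord => -[i /= si ti].
  rewrite /step_fun/= (bigD1 (Ordinal si))//= big1 => [|j ji].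
    rewrite addr0 indicE mem_set// scale1r.
    by case: ti.
  rewrite indicE memNset ?scale0r// => tj.
  have /eqP := @trivIset_seqDU _ G j i I I (ex_intro _ t (conj tj ti)).
  by move=> /eqP jiE; move: ji; rewrite -val_eqE/= jiE eqxx.
apply: filter_from_filter; first by exists 1; rewrite /=.
move=> e1 e2 /= e10 e20; exists (Num.min e1 e2); first by rewrite /= lt_min e10.
by move=> s /= h; split=> t; have := h t; rewrite lt_min => /andP[].
Qed.

(* [Tadj] is the adjoint of [T_op] *)
Lemma vint_Tadj (hK : hausdorff_space K) (nu : radon_measure R KB) (g : K -> E) :
  compact [set: K] -> continuous g ->
  vint (Tadj hK nu) g = scalar_integral nu setT (T_op g).
Proof.
move=> cK cg; have PF := unif_step_proper cK cg.
apply: (@cvg_lim F^o); first exact: norm_hausdorff.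
move=> A /nbhs_rnormP[e e0 eA].
have M0 : 0 < 2 * (fine (nu setT) + 1).
  by rewrite mulr_gt0// ltr_wpDl// fine_ge0.
exists (e / (2 * (fine (nu setT) + 1))) => /=; first by rewrite divr_gt0.
move=> s /= sg; apply: eA.
have [bs ->] := step_int_Tadj nu hK s.
have bg := T_op_continuous_sbounded cK cg.
have -> : scalar_integral nu setT (T_op g) - scalar_integral nu setT (T_op (step_fun s)) =
    scalar_integral nu setT (fun z => -1 * T_op (step_fun s) z + T_op g z).
  by rewrite scalar_integral_linear// mulN1r addrC.
set d := e / _ in sg.
have d0 : 0 < d by rewrite divr_gt0.
apply: (@le_lt_trans _ _ (2 * (d * fine (nu setT)))).
  apply: scalar_integral_bound => //.
    have [mre mim [M hM]] := bs; have [mre' mim' [M' hM']] := bg.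
    split.
    - under eq_fun do rewrite mulN1r sReD sReN.
      by apply: measurable_funD => //; exact: measurableT_comp.
    - under eq_fun do rewrite mulN1r sImD sImN.
      by apply: measurable_funD => //; exact: measurableT_comp.
    - exists (M + M') => z; rewrite (le_trans (ler_rnormD _ _))// lerD//.
      by rewrite mulN1r /rnorm normrN; exact: hM.
  move=> z _; rewrite mulN1r addrC /T_op -linearB/=.
  rewrite (le_trans (dnorm_ub _ _))// (le_trans _ (ltW (sg z.1)))//.
  by rewrite -[leRHS]mul1r ler_wpM2r// ?rnorm_ge0//; exact: (svalP z.2).
rewrite mulrCA -[ltRHS](divfK (lt0r_neq0 M0)) -/d ltr_pM2l//.
by rewrite ltr_pM2l// ltrDl.
Qed.

End adjoint_correct.

Section batty.
Context (R : realType) (k : scalar_kind) (K : ptopologicalType)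
  (E : normedModType (scalar_field R k)).
Local Notation F := (scalar_field R k).
Local Notation KB := (K * weak_star_ball E)%type.

Definition superlinear (f : cdual E -> R) :=
  (forall x y, f x + f y <= f (x + y)) /\
  (forall (a : R) x, 0 < a -> f (sMk k a 0 *: x) = a * f x).

(* the first two conditions concern the restriction of [f] to [KB] *)
Definition batty_D (f : K -> cdual E -> R) :=
  [/\ lower_semicontinuous (fun z : KB => (- f z.1 (sval z.2))%:E),
      exists M : R, forall z : KB, `|f z.1 (sval z.2)| <= M &
      forall t, superlinear (f t)].

(* in the extended reals, so that the infimum is meaningful unconditionally *)
Definition batty_p (f : K -> cdual E -> R) (mu : vmeasure K E) : \bar R :=
  ereal_inf [set (sRe (vint mu g))%:E | g in
    [set g : K -> E | continuous g /\ forall t x, f t x <= sRe (x (g t))]].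

Definition is_batty_W (mu : vmeasure K E) (w : radon_measure R KB) :=
  radon_norm w = vmeasure_norm mu /\
  forall f, batty_D f -> (\int[w]_z (f z.1 (sval z.2))%:E = batty_p f mu)%E.

(* the unique such measure, up to [borel_eq] *)
Definition batty_W (mu : vmeasure K E) : radon_measure R KB :=
  get (is_batty_W mu).

Definition strictly_convex_dual : Prop :=
  forall x y : cdual E, dnorm x = 1 -> dnorm y = 1 -> x <> y ->
  dnorm (x + y) < 2.

End batty.

(* Main.v *)
(* Let nu be a positive measure on K x B with |T^* nu| = |nu|.  Step functions h_n
   that norm T^* nu satisfy Re y(h_n(t)) -> 1 for nu-almost all (t, y); if E^* is
   strictly convex, at most one y above each t can do this, so nu lives on a graph
   over K.  The marginal of nu on K is determined by T^* nu, and a measure on a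
   graph is determined by its marginal; this gives uniqueness.

   For W T^* nu = nu, the point is p_f(T^* nu) <= int f dnu.  On a compact piece C of
   the graph where f is almost continuous, a minimax argument yields for each (t, y)
   in C a vector v with f(t, .) <= Re .(v) + d and Re y(v) <= f(t, y) + d; partitions
   of unity glue these vectors to a continuous g, which is then cut off away from the
   projection of C and corrected (as in Michael's selection theorem, by a convergent
   series) so as to dominate f exactly.

   If x and y are distinct unit vectors with |x + y| = 2, then the Dirac mass at the
   midpoint of x and y, and half the sum of the Dirac masses at x and at y, violate
   uniqueness. *)

Require Import Defs.
From HB Require Import structures.
From mathcomp Require Import all_boot all_order all_algebra.
From mathcomp Require Import all_classical all_reals all_analysis.
From mathcomp Require Import measurable_realfun ring lra.
Import Order.TTheory GRing.Theory Num.Theory.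
Import numFieldNormedType.Exports.

Set Implicit Arguments.
Unset Strict Implicit.
Unset Printing Implicit Defensive.

Local Open Scope classical_set_scope.
Local Open Scope ring_scope.

(** * Minimax *)

(** A majorant of a superlinear function has to be evaluation at a vector of [E], while a
    Hahn-Banach argument in general only produces an element of the bidual. Upper semicontinuity on
    the weak* compact ball together with minimax does produce vectors of [E], but up to an error
    [d]; this is why majorants are first approximate, and completeness of [E] serves to remove the
    error at the end. Since f is merely upper semicontinuous, the condition f <= Re + d spreads from
    one fibre to the neighbouring ones, whereas touching from above spreads only with lower
    semicontinuity, available along a compact part of the graph. Touching also needs y <> 0, which
    holds on the graph because its points have norm one. The measure nu then satisfies the
    definition of W T^* nu, so existence of W is proved where it is used; that W T^* nu has the same
    adjoint image as nu follows by testing with real parts of evaluations. Conversely, (3) gives (2)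
    because W T^* nu depends only on T^* nu. *)

(** Up to domination, the points (g y, h y) form a convex set that misses {g > 0, h >= 0}; the
    weights describe a line through the origin separating the two. *)
Lemma two_function_minimax {R : realType} {Y : Type} (D : set Y) (g h : Y -> R) :
  (forall y1 y2 a, D y1 -> D y2 -> 0 <= a <= 1 -> exists y, [/\ D y,
     a * g y1 + (1 - a) * g y2 <= g y & a * h y1 + (1 - a) * h y2 <= h y]) ->
  (forall y, D y -> 0 <= h y -> g y <= 0) ->
  exists2 a, 0 <= a <= 1 & forall y, D y -> a * g y + (1 - a) * h y <= 0.
Proof.
move=> conc hg.
have [[y0 [Dy0 gy0]]|no] := pselect (exists y, D y /\ 0 < g y); last first.
  exists 1 => [|y Dy]; first by rewrite ler01 lexx.
  rewrite subrr mul0r addr0 mul1r leNgt; apply/negP => gy.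
  by apply: no; exists y.
have hneg y : D y -> 0 < g y -> h y < 0.
  by move=> Dy gy; rewrite ltNge; apply/negP => /(hg _ Dy); rewrite leNgt gy.
(* [r] is the largest slope with [g * r + h <= 0] on [{g > 0}]; the other points
   obey the same inequality by concavity. *)
pose S := [set - h y / g y | y in [set y | D y /\ 0 < g y]].
have S0 : lbound S 0.
  by move=> _ [y [Dy gy] <-]; apply: divr_ge0; rewrite ?oppr_ge0 ltW// hneg.
have Si : has_inf S.
  by split; [exists (- h y0 / g y0), y0|exists 0].
pose r := inf S.
have r0 : 0 <= r by apply: lb_le_inf; [exact: Si.1|exact: S0].
have r1 : 0 < 1 + r by rewrite ltr_wpDr.
suff key y : D y -> g y * r + h y <= 0.
  exists (r / (1 + r)) => [|y Dy].
    by rewrite ler_pdivrMr// mul1r divr_ge0 ?(ltW r1)//= lerDr.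
  have -> : r / (1 + r) * g y + (1 - r / (1 + r)) * h y =
      (g y * r + h y) / (1 + r) by field; rewrite gt_eqF.
  by rewrite pmulr_lle0 ?invr_gt0//; exact: key.
move=> Dy.
have [gy|gy] := ltP 0 (g y).
  have : r <= - h y / g y by apply: ge_inf; [exact: Si.2|exists y].
  by rewrite ler_pdivlMr// mulrC; lra.
have [hy|hy] := leP (h y) 0.
  have : g y * r <= 0 by rewrite mulr_le0_ge0.
  lra.
have hgy (z : Y) : D z -> 0 < g z -> h y * g z <= h z * g y.
  move=> Dz gz; rewrite leNgt; apply/negP => lt.
  have hz := hneg _ Dz gz.
  have d0 : 0 < h y - h z by lra.
  (* At this weight the combination of [h] vanishes, so the hypothesis on [h >= 0] applies, while
     the combination of [g] would be positive. *)
  pose a := h y / (h y - h z).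
  have a01 : 0 <= a <= 1.
    by rewrite /a ler_pdivrMr// mul1r divr_ge0 ?(ltW hy) ?(ltW d0)//=; lra.
  have [w [Dw gw hw]] := conc z y a Dz Dy a01.
  have hw0 : 0 <= h w.
    apply: le_trans hw; have -> // : a * h z + (1 - a) * h y = 0.
    by rewrite /a; field; rewrite gt_eqF.
  have := hg w Dw hw0; rewrite leNgt => /negP; apply.
  apply: lt_le_trans gw.
  have -> : a * g z + (1 - a) * g y = (h y * g z - h z * g y) / (h y - h z).
    by rewrite /a; field; rewrite gt_eqF.
  by rewrite divr_gt0// subr_gt0.
have gy' : g y < 0.
  rewrite lt_neqAle gy andbT; apply/eqP => gy'.
  have := hgy _ Dy0 gy0; rewrite gy' mulr0 leNgt => /negP; apply.
  by rewrite mulr_gt0.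
have : h y / - g y <= r.
  apply: lb_le_inf; first exact: Si.1.
  move=> _ [z [Dz gz] <-]; rewrite ler_pdivlMr// mulrAC ler_pdivrMr ?oppr_gt0//.
  by have := hgy _ Dz gz; lra.
rewrite ler_pdivrMr ?oppr_gt0//; lra.
Qed.

(** Where [h x1 >= 0], the witness of negativity is never [x1], so the induction hypothesis for that
    part of [D] gives an [x']; the two-function case then mixes [x'] with [x1]. Hence [D] has to
    vary in the induction. *)
Lemma finite_minimax {R : realType} {X : eqType} {Y : Type} (P : set X) (D : set Y)
    (h : X -> Y -> R) (x0 : X) (s : seq X) :
  (forall x1 x2 a, P x1 -> P x2 -> 0 <= a <= 1 -> exists2 x, P x &
     forall y, h x y <= a * h x1 y + (1 - a) * h x2 y) ->
  (forall y1 y2 a, D y1 -> D y2 -> 0 <= a <= 1 -> exists2 y, D y &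
     forall x, P x -> a * h x y1 + (1 - a) * h x y2 <= h x y) ->
  (forall x, x \in x0 :: s -> P x) ->
  (forall y, D y -> exists2 x, x \in x0 :: s & h x y < 0) ->
  exists2 x, P x & forall y, D y -> h x y <= 0.
Proof.
move=> cvxX; elim: s D => [|x1 s ih] D cncY sP neg.
  exists x0 => [|y /neg[x]]; first by apply: sP; rewrite inE.
  by rewrite inE => /eqP -> /ltW.
have Px1 : P x1 by apply: sP; rewrite !inE eqxx orbT.
pose D' := D `&` [set y | 0 <= h x1 y].
have [| | |x' Px' hx'] := ih D'.
- move=> y1 y2 a [D1 h1] [D2 h2] a01.
  have [y Dy hy] := cncY _ _ _ D1 D2 a01.
  exists y => //; split => //; apply: le_trans (hy x1 Px1).
  by case/andP: a01 => a0 a1; rewrite addr_ge0// mulr_ge0// subr_ge0.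
- by move=> x xs; apply: sP; move: xs; rewrite !inE => /orP[->|->]; rewrite ?orbT.
- move=> y [Dy hy]; have [x + hxy] := neg y Dy.
  rewrite !inE => /or3P[xx0|/eqP xx1|xs].
  + by exists x => //; rewrite inE xx0.
  + by move: hxy; rewrite xx1 ltNge hy.
  + by exists x => //; rewrite inE xs orbT.
have [||a a01 ha] := @two_function_minimax R Y D (h x') (h x1).
- move=> y1 y2 a D1 D2 a01; have [y Dy hy] := cncY _ _ _ D1 D2 a01.
  by exists y; split => //; exact: hy.
- by move=> y Dy hy; apply: hx'.
have [x Px hx] := cvxX _ _ _ Px' Px1 a01.
by exists x => // y Dy; apply: le_trans (ha y Dy).
Qed.

(** The open sets where [h x] is negative cover [Y]; a finite subcover supplies the list for
    [finite_minimax]. *)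
Lemma compact_minimax {R : realType} {X : choiceType} {Y : ptopologicalType}
    (P : set X) (h : X -> Y -> R) :
  compact [set: Y] ->
  (forall x1 x2 a, P x1 -> P x2 -> 0 <= a <= 1 -> exists2 x, P x &
     forall y, h x y <= a * h x1 y + (1 - a) * h x2 y) ->
  (forall y1 y2 a, 0 <= a <= 1 -> exists y,
     forall x, P x -> a * h x y1 + (1 - a) * h x y2 <= h x y) ->
  (forall x, P x -> open [set y | h x y < 0]) ->
  (forall y, exists2 x, P x & h x y < 0) ->
  exists2 x, P x & forall y, h x y <= 0.
Proof.
move=> cY cvxX cncY oh neg.
have [x0 Px0 _] := neg point.
move: cY; rewrite compact_cover.
move=> /(_ X P (fun x => [set y | h x y < 0]) oh)[y _|S SP cS].
  by have [x Px hx] := neg y; exists x.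
have [| | |x Px hx] := @finite_minimax R X Y P setT h x0 (finmap.enum_fset S) cvxX.
- by move=> y1 y2 a _ _ a01; have [y hy] := cncY y1 y2 a a01; exists y.
- by move=> x; rewrite inE => /orP[/eqP -> //|xS]; have := SP x xS; rewrite inE.
- by move=> y _; have [x xS hx] := cS y I; exists x => //; rewrite inE xS orbT.
- by exists x => // y; exact: hx.
Qed.

(** * Scalars, functionals and the weak* compact ball *)

Section scalar_lemmas.
Context (R : realType) (k : scalar_kind).
Local Notation F := (scalar_field R k).

Lemma sReZ (a : R) (z : F) : sRe (sMk k a 0 * z) = a * sRe z.
Proof.
rewrite sReM sReMk; suff -> : sIm (sMk k a 0) = 0 :> R by rewrite mul0r subr0.
by case: k.
Qed.

Lemma sImZ (a : R) (z : F) : sIm (sMk k a 0 * z) = a * sIm z.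
Proof.
rewrite sImM sReMk; suff -> : sIm (sMk k a 0) = 0 :> R by rewrite mul0r addr0.
by case: k.
Qed.

(* [sMk k 0 1] is [i] over the complex scalars and [0] over the real ones. *)
Lemma sIm_sRe (z : F) : sIm z = - sRe (sMk k 0 1 * z).
Proof.
by case: k z => [z|[a b]] /=; rewrite ?mul0r ?oppr0 // mul1r sub0r opprK.
Qed.

Lemma sMkM (a b : R) : sMk k (a * b) 0 = sMk k a 0 * sMk k b 0.
Proof.
apply: sext; rewrite ?sReZ ?sImZ ?sReMk//.
by case: k => /=; rewrite /cst ?mulr0.
Qed.

Lemma sMk1 : sMk k 1 0 = 1 :> F.
Proof. by case: k. Qed.

Lemma sMk00 : sMk k 0 0 = 0 :> F.
Proof. by case: k. Qed.

Lemma rnorm_sMk (a : R) : rnorm (sMk k a 0 : F^o) = `|a|.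
Proof.
rewrite rnorm_scalarE sReMk.
suff -> : sIm (sMk k a 0) = 0 :> R by rewrite expr0n addr0 sqrtr_sqr.
by case: k.
Qed.

Lemma rnormN (V : normedModType F) (v : V) : rnorm (- v) = rnorm v.
Proof. by rewrite /rnorm normrN. Qed.

Lemma rnorm_eq0 (V : normedModType F) (v : V) : rnorm v = 0 -> v = 0.
Proof. by move=> v0; apply/eqP; rewrite -normr_le0 -(normr0 V) rnorm_le v0 rnorm0. Qed.

Lemma rnormZr (V : normedModType F) (a : R) (v : V) :
  rnorm (sMk k a 0 *: v) = `|a| * rnorm v.
Proof. by rewrite rnormZ rnorm_sMk. Qed.

Lemma rnorm_continuous (V : normedModType F) : continuous (@rnorm R k V).
Proof.
apply: rnorm_continuous_R => v w; rewrite ler_norml; apply/andP; split.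
  rewrite lerNl opprB lerBlDr -{1}(subrK v w) (le_trans (ler_rnormD _ _))//.
  by rewrite lerD2r /rnorm distrC.
by rewrite lerBlDr -{1}(subrK w v) ler_rnormD.
Qed.

Lemma sMk_continuous (V : topologicalType) (f g : V -> R) :
  continuous f -> continuous g -> continuous (fun x => sMk k (f x) (g x) : F^o).
Proof.
move=> cf cg x A /nbhs_rnormP[e e0 eA].
have e2 : 0 < e / 2 by rewrite divr_gt0.
have /cvgrPdist_lt/(_ _ e2) fx := cf x.
have /cvgrPdist_lt/(_ _ e2) gx := cg x.
change (\forall y \near x, A (sMk k (f y) (g y))).
near=> y; apply: eA.
have fy : `|f x - f y| < e / 2 by near: y.
have gy : `|g x - g y| < e / 2 by near: y.
apply: le_lt_trans (ler_rnorm_sReIm _) _.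
rewrite sReD sReN !sReMk [ltRHS]splitr ltr_leD// (le_trans _ (ltW gy))//.
by case: k => /=; rewrite /cst ?subr0 ?normr0.
Unshelve. all: by end_near. Qed.

Lemma rnorm_rotation (z : F) :
  exists2 u : F, rnorm (u : F^o) <= 1 & sRe (u * z) = rnorm (z : F^o).
Proof.
have [z0|z0] := eqVneq (rnorm (z : F^o)) 0.
  by exists 0; rewrite ?rnorm0// mul0r sRe0 z0.
set r := rnorm (z : F^o) in z0 *.
have r0 : 0 < r by rewrite lt_def z0 rnorm_ge0.
have rE : r ^+ 2 = sRe z ^+ 2 + sIm z ^+ 2.
  by rewrite /r rnorm_scalarE sqr_sqrtr// addr_ge0// sqr_ge0.
(* [w] is the conjugate of [z]; the rotation is [w] divided by the modulus of [z]. *)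
pose w := sMk k (sRe z) (- sIm z).
have wI : sIm w = - sIm z by rewrite /w -sImN sImMk.
exists (sMk k r^-1 0 * w).
  rewrite -[_ * _]/(sMk k r^-1 0 *: (w : F^o)) rnormZr.
  have -> : rnorm (w : F^o) = r.
    by rewrite rnorm_scalarE wI /w sReMk sqrrN /r rnorm_scalarE.
  by rewrite ger0_norm ?invr_ge0 ?(ltW r0)// mulVf.
rewrite -mulrA sReZ sReM wI /w sReMk mulNr opprK -!expr2 -rE expr2.
by rewrite mulKf.
Qed.

End scalar_lemmas.

Section dual_lemmas.
Context (R : realType) (k : scalar_kind) (E : normedModType (scalar_field R k)).
Local Notation F := (scalar_field R k).
Implicit Types (x y : cdual E) (v w : E).

Lemma cdualD x y v : (x + y) v = x v + y v. Proof. by []. Qed.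
Lemma cdualZ (a : F) x v : (a *: x) v = a * x v. Proof. by []. Qed.
Lemma cdual0 v : (0 : cdual E) v = 0. Proof. by []. Qed.

Lemma sRe_cdualZl (a : R) x v : sRe ((sMk k a 0 *: x) v) = a * sRe (x v).
Proof. by rewrite cdualZ sReZ. Qed.

Lemma sRe_cdualZr (a : R) x v : sRe (x (sMk k a 0 *: v)) = a * sRe (x v).
Proof. by rewrite linearZ sReZ. Qed.

Lemma sRe_cdualD x v w : sRe (x (v + w)) = sRe (x v) + sRe (x w).
Proof. by rewrite linearD sReD. Qed.

Lemma sRe_cdualN x v : sRe (x (- v)) = - sRe (x v).
Proof. by rewrite linearN sReN. Qed.

Lemma sRe_cdualB x v w : sRe (x (v - w)) = sRe (x v) - sRe (x w).
Proof. by rewrite sRe_cdualD sRe_cdualN. Qed.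

Lemma cdual_ext x y : (forall v, sRe (x v) = sRe (y v)) -> x = y.
Proof.
move=> xy; apply/val_inj/funext => v; apply: sext; first exact: xy.
by rewrite !sIm_sRe; congr (- _); have := xy (sMk k 0 1 *: v); rewrite !linearZ.
Qed.

Lemma ler_sRe_dnorm x v : sRe (x v) <= dnorm x * rnorm v.
Proof.
by rewrite (le_trans (ler_norm _))// (le_trans (ler_sRe_rnorm _))// dnorm_ub.
Qed.

Lemma ler_normRe_dnorm x v : `|sRe (x v)| <= dnorm x * rnorm v.
Proof. by rewrite (le_trans (ler_sRe_rnorm _))// dnorm_ub. Qed.

(** A scalar factor of modulus at most 1 on [v] turns the modulus of [x v] into a real part. *)
Lemma dnorm_leRe x (M : R) : 0 <= M ->
  (forall v, sRe (x v) <= M * rnorm v) -> dnorm x <= M.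
Proof.
move=> M0 xM; apply: dnorm_le => // v.
have [u u1 <-] := rnorm_rotation (x v).
rewrite -[u * _]/(u *: (x v : F^o)) -linearZ (le_trans (xM _))//.
by rewrite rnormZ ler_wpM2l// ler_piMl// rnorm_ge0.
Qed.

Lemma dnorm_approx x (e : R) : 0 < e ->
  exists2 v, rnorm v <= 1 & dnorm x - e < sRe (x v).
Proof.
move=> e0; have [xe|xe] := ltP (dnorm x) e.
  by exists 0; rewrite ?rnorm0// linear0 sRe0 subr_lt0.
apply: contrapT => nv.
have : dnorm x <= dnorm x - e.
  apply: dnorm_leRe => [|v]; first by rewrite subr_ge0.
  have [v0|v0] := eqVneq (rnorm v) 0.
    by rewrite (rnorm_eq0 v0) linear0 sRe0 rnorm0 mulr0.
  have {}v0 : 0 < rnorm v by rewrite lt_def v0 rnorm_ge0.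
  rewrite leNgt; apply/negP => lt; apply: nv.
  exists (sMk k (rnorm v)^-1 0 *: v).
    by rewrite rnormZr ger0_norm ?invr_ge0 ?(ltW v0)// mulVf ?gt_eqF.
  by rewrite sRe_cdualZr mulrC ltr_pdivlMr.
by rewrite leNgt ltrBlDr ltrDl e0.
Qed.

Lemma ler_dnormD x y : dnorm (x + y) <= dnorm x + dnorm y.
Proof.
apply: dnorm_leRe => [|v]; first by rewrite addr_ge0// Defs.dnorm_ge0.
by rewrite cdualD sReD mulrDl lerD// ler_sRe_dnorm.
Qed.

Lemma dnorm_cdual0 : dnorm (0 : cdual E) = 0.
Proof.
apply/eqP; rewrite eq_le Defs.dnorm_ge0 andbT; apply: dnorm_leRe => // v.
by rewrite cdual0 sRe0 mul0r.
Qed.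

Lemma dnormZr (a : R) x : 0 <= a -> dnorm (sMk k a 0 *: x) = a * dnorm x.
Proof.
move=> a0.
have le (b : R) y : 0 <= b -> dnorm (sMk k b 0 *: y) <= b * dnorm y.
  move=> b0; apply: dnorm_leRe => [|v]; first by rewrite mulr_ge0// Defs.dnorm_ge0.
  by rewrite sRe_cdualZl -mulrA ler_wpM2l// ler_sRe_dnorm.
have [->|an0] := eqVneq a 0.
  by rewrite sMk00 scale0r dnorm_cdual0 mul0r.
apply/eqP; rewrite eq_le le//= -ler_pdivlMl ?lt_def ?an0//.
have {1}-> : x = sMk k a^-1 0 *: (sMk k a 0 *: x).
  by rewrite scalerA -sMkM mulVf// sMk1 scale1r.
by rewrite le// invr_ge0.
Qed.

Lemma dnorm_eq0 x : dnorm x = 0 -> x = 0.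
Proof.
move=> x0; apply: cdual_ext => v; apply/eqP; rewrite cdual0 sRe0 -normr_le0.
by rewrite (le_trans (ler_normRe_dnorm _ _))// x0 mul0r.
Qed.

End dual_lemmas.

(** * Weak* compactness of the dual ball *)

Section alaoglu.
Context (R : realType) (k : scalar_kind) (E : normedModType (scalar_field R k)).
Local Notation F := (scalar_field R k).
Local Notation WB := (weak_star_ball E).

(** A box instead of a disc, because it is a continuous image of a product of segments over either
    scalar field. *)
Lemma compact_scalar_box (r : R) :
  compact [set (sMk k ab.1 ab.2 : F^o) | ab in (`[- r, r] `*` `[- r, r])].
Proof.
apply: continuous_compact; last by apply: compact_setX; exact: segment_compact.
apply: continuous_subspaceT; apply: sMk_continuous => z.
  exact: cvg_fst.
exact: cvg_snd.
Qed.

Let ev (x : WB) : {ptws E -> F^o} := fun v => sval x v.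

(** Tychonoff gives a cluster point in a product of boxes. Linearity and the norm bound are closed
    conditions, so this point is an element of the ball, and it is a cluster point there because the
    topology of the ball is initial. *)
Lemma weak_star_ball_compact : compact [set: WB].
Proof.
move=> P PP _.
pose B (v : E) := [set (sMk k ab.1 ab.2 : F^o) |
  ab in (`[- rnorm v, rnorm v] `*` `[- rnorm v, rnorm v])].
have := @tychonoff E (fun _ => F^o) B (fun v => @compact_scalar_box (rnorm v)).
move=> /(_ (ev @ P) (fmap_proper_filter _ _))[].
  have evb (x : WB) v : rnorm (ev x v) <= rnorm v.
    rewrite (le_trans (dnorm_ub _ _))// -[leRHS]mul1r ler_wpM2r ?rnorm_ge0//.
    exact: (svalP x).
  rewrite /fmap/=; apply: filterE => x /= v.
  exists (sRe (ev x v), sIm (ev x v)); last exact: sMkK.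
  by split => /=; rewrite in_itv/= -ler_norml (le_trans _ (evb x v))//;
    [exact: ler_sRe_rnorm|exact: ler_sIm_rnorm].
move=> f [_ fcl].
(* The cluster point [f] inherits every closed condition that all evaluations of the ball
   satisfy. *)
have clf (Z : set {ptws E -> F^o}) : closed Z -> (forall x, Z (ev x)) -> Z f.
  move=> cZ Zx; apply: cZ => V fV.
  have [] := fcl Z V _ fV; first by change (P (ev @^-1` Z)); apply: filterE => x; exact: Zx.
  by move=> g [Zg Vg]; exists g.
have cproj v : continuous (fun g : {ptws E -> F^o} => (g v : F^o)).
  exact: proj_continuous.
have flin : linear (f : E -> F^o).
  move=> a u v; apply/eqP; rewrite -subr_eq0; apply/eqP.
  pose d (g : {ptws E -> F^o}) : F^o := g (a *: u + v) - (a *: (g u : F^o) + g v).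
  have cd : continuous d.
    move=> g.
    have c1 := cproj (a *: u + v) g.
    have c2 : (a *: (h u : F^o) @[h --> g] --> a *: (g u : F^o)).
      exact: (cvgZr (cproj u g)).
    have := cvgB c1 (cvgD c2 (cproj v g)).
    by apply; exact: (@nbhs_filter {ptws E -> F^o} g).
  apply: (clf (d @^-1` [set 0])) => [|x].
    move/continuous_closedP : cd => /(_ [set 0]); apply.
    exact: (accessible_closed_set1 (hausdorff_accessible (@norm_hausdorff F F^o))).
  by rewrite /d /= /ev linearP subrr.
have fbound v : rnorm (f v : F^o) <= rnorm v.
  apply: (clf ((fun g : {ptws E -> F^o} => rnorm (g v : F^o)) @^-1`
      [set r : R | r <= rnorm v])) => [|x].
    suff /continuous_closedP : continuous
        (fun g : {ptws E -> F^o} => rnorm (g v : F^o)).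
      by move=> /(_ [set r : R | r <= rnorm v]); apply; exact: closed_le.
    move=> g; exact: (@continuous_comp {ptws E -> F^o} F^o R (fun h => h v)
      (@rnorm R k F^o) g (cproj v g) (@rnorm_continuous R k F^o (g v))).
  rewrite /= (le_trans (dnorm_ub _ _))// -[leRHS]mul1r ler_wpM2r ?rnorm_ge0//.
  exact: (svalP x).
have fdual : (f : E -> F^o) \in @dual_pred R k E.
  rewrite inE; split => //; apply: (@rnorm_lipschitz_continuous _ _ _ _ _ 1) => // v w.
  have -> : f v - f w = f (v - w).
    have -> : v - w = -1 *: w + v by rewrite scaleN1r addrC.
    by rewrite flin scaleN1r addrC.
  by rewrite mul1r.
have f1 : dnorm (CDual fdual) <= 1 by apply: dnorm_le => // v; rewrite mul1r; exact: fbound.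
exists (exist _ (CDual fdual) f1); split => // A V PA.
rewrite nbhsE => -[_ [[W oW <-] Wf] WV].
have [] := fcl (ev @` A) W.
- change (P (ev @^-1` (ev @` A))).
  by apply: filterS PA => x Ax; exists x.
- by apply: open_nbhs_nbhs; split.
- by move=> _ [[x Ax <-] Wx]; exists x; split => //; exact: WV.
Qed.

End alaoglu.

(** * Semicontinuity and selections *)

Section upper_semicontinuity.
Context (R : realType).

Definition usc (T : topologicalType) (f : T -> R) :=
  forall x e, 0 < e -> \forall y \near x, f y < f x + e.

Lemma uscP (T : topologicalType) (f : T -> R) :
  lower_semicontinuous (fun x => (- f x)%:E) <-> usc f.
Proof.
split=> [lf x e e0|uf x a].
  have [|V xV Vf] := lf x (- f x - e); first by rewrite lte_fin ltrBlDr ltrDl.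
  by apply: filterS xV => y /Vf; rewrite lte_fin; lra.
rewrite lte_fin => ax; exists [set y | f y < f x + (- f x - a)].
  by apply: uf; rewrite subr_gt0.
by move=> y /=; rewrite lte_fin; lra.
Qed.

Lemma usc_open (T : topologicalType) (f : T -> R) (a : R) :
  usc f -> open [set x | f x < a].
Proof.
move=> uf; rewrite openE => x /= fa.
have : 0 < a - f x by rewrite subr_gt0.
by move=> /(uf x); rewrite addrC subrK.
Qed.

Lemma usc_comp (S T : topologicalType) (g : S -> T) (f : T -> R) :
  continuous g -> usc f -> usc (f \o g).
Proof. by move=> cg uf x e e0; exact: (cg x _ (uf (g x) e e0)). Qed.

Lemma uscB (T : topologicalType) (f g : T -> R) :
  usc f -> continuous g -> usc (fun x => f x - g x).
Proof.
move=> uf cg x e e0; have e2 : 0 < e / 2 by rewrite divr_gt0.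
have /cvgrPdist_lt/(_ _ e2) gx := cg x.
have fx := uf x _ e2.
near=> y.
have : `|g x - g y| < e / 2 by near: y.
have : f y < f x + e / 2 by near: y.
by rewrite ltr_norml => ? /andP[]; lra.
Unshelve. all: by end_near. Qed.

End upper_semicontinuity.

(** The tube lemma, from the near-covering form of compactness. *)
Lemma compact_tube (S T : topologicalType) (s : S) (Q : S * T -> Prop) :
  compact [set: T] -> (forall t : T, nbhs ((s, t) : (S * T)%type) Q) ->
  \forall s' \near s, forall t, Q (s', t).
Proof.
move=> /compact_near_coveringP cT sQ.
have := cT S (nbhs s) (fun s' t => Q (s', t)) _.
have st t : [set: T] t -> \forall t' \near t & s' \near s, Q (s', t').
  move=> _; have [[A B] [/= sA tB] AB] := sQ t.
  by exists (B, A) => // -[t' s'] [/= Bt As]; exact: (AB (s', t')).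
by move=> /(_ _ st); apply: filterS => s' sT t; exact: sT.
Qed.

(** * Convex combinations and continuous selections *)

Section convexity.
Context (R : realType) (k : scalar_kind) (E : normedModType (scalar_field R k)).
Local Notation F := (scalar_field R k).

Definition convex_set_of (C : set E) := forall v w (a : R), C v -> C w -> 0 <= a <= 1 ->
  C (sMk k a 0 *: v + sMk k (1 - a) 0 *: w).

(** The induction runs on unnormalised sums: [D a u] says that [u] is [a] times a point of [C], with
    the empty sum as the case [a = 0]. Points of weight zero may lie outside [C]. *)
Lemma convex_combination (I : Type) (s : seq I) (w : I -> R) (v : I -> E) (C : set E) :
  convex_set_of C -> (forall i, 0 <= w i) -> (forall i, 0 < w i -> C (v i)) ->
  0 < \sum_(i <- s) w i ->
  C (sMk k (\sum_(i <- s) w i)^-1 0 *: \sum_(i <- s) sMk k (w i) 0 *: v i).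
Proof.
move=> cC w0 wC.
pose D (a : R) (u : E) := (a = 0 /\ u = 0) \/ (0 < a /\ C (sMk k a^-1 0 *: u)).
suff : D (\sum_(i <- s) w i) (\sum_(i <- s) sMk k (w i) 0 *: v i).
  by move=> [[-> _]|[]//]; rewrite ltxx.
apply: (big_rec2 (fun u a => D a u)) => [|i u a _ [[-> ->]|[a0 Ca]]].
- by left.
- rewrite !addr0; have [->|wi] := eqVneq (w i) 0.
    by left; rewrite sMk00 scale0r.
  right; split; first by rewrite lt_def wi w0.
  by rewrite scalerA -sMkM mulVf// sMk1 scale1r; apply: wC; rewrite lt_def wi w0.
- have [->|wi] := eqVneq (w i) 0.
    by right; rewrite sMk00 scale0r !add0r.
  have {}wi : 0 < w i by rewrite lt_def wi w0.
  have wa : 0 < w i + a by rewrite addr_gt0.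
  right; split => //.
  have -> : sMk k (w i + a)^-1 0 *: (sMk k (w i) 0 *: v i + u) =
      sMk k (w i / (w i + a)) 0 *: v i +
      sMk k (1 - w i / (w i + a)) 0 *: (sMk k a^-1 0 *: u).
    rewrite scalerDr !scalerA -!sMkM mulrC; congr (_ + sMk k _ 0 *: _).
    by field; rewrite !gt_eqF.
  apply: cC => //; first exact: wC.
  by rewrite ler_pdivrMr// mul1r divr_ge0 ?(ltW wa) ?(ltW wi)//= lerDl ltW.
Qed.

Lemma sum_continuous (T : topologicalType) (I : Type) (s : seq I) (f : I -> T -> E) :
  (forall i, continuous (f i)) -> continuous (fun t => \sum_(i <- s) f i t).
Proof.
move=> cf; elim: s => [|i s ih] t.
  under eq_fun do rewrite big_nil.
  exact: cvg_cst.
under eq_fun do rewrite big_cons.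
by apply: cvgD; [exact: cf|exact: ih].
Qed.

Lemma sum_continuousR (T : topologicalType) (I : Type) (s : seq I) (f : I -> T -> R) :
  (forall i, continuous (f i)) -> continuous (fun t => \sum_(i <- s) f i t).
Proof.
move=> cf; elim: s => [|i s ih] t.
  under eq_fun do rewrite big_nil.
  exact: cvg_cst.
under eq_fun do rewrite big_cons.
by apply: cvgD; [exact: cf|exact: ih].
Qed.

Lemma scale_continuous (T : topologicalType) (a : T -> R) (f : T -> E) :
  continuous a -> continuous f -> continuous (fun t => sMk k (a t) 0 *: f t).
Proof.
move=> ca cf t; apply: cvgZ; last exact: cf.
apply: (@sMk_continuous R k T a (cst 0)) => //.
exact: cst_continuous.
Qed.

Lemma pointwise_bump (K : topologicalType) (U : set K) (t : K) :
  compact [set: K] -> hausdorff_space K -> nbhs t U ->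
  exists p : K -> R, [/\ continuous p, forall s, 0 <= p s, p t = 1 &
    forall s, 0 < p s -> U s].
Proof.
move=> cK hK tU.
have nK := compact_normal hK cK.
have [|||p [cp p0 p1 pr]] :=
  @urysohn_ext_itv K R nK (~` (interior U)) [set t] 0 1 _ _ _ ltr01.
- by apply: open_closedC; exact: open_interior.
- exact: (accessible_closed_set1 (hausdorff_accessible hK)).
- by apply/seteqP; split=> // s [/= + st]; rewrite st; apply.
exists p; split => //.
- move=> s; have : range p (p s) by exists s.
  by move=> /pr; rewrite /= in_itv/= => /andP[].
- by apply: p1; exists t.
- move=> s ps; apply: interior_subset; apply: contrapT => nUs.
  have : p s = 0 by apply: p0; exists s.
  by move=> p0'; move: ps; rewrite p0' ltxx.
Qed.

(** Each [v t] lies in [P s] wherever its bump is positive, so at every point the normalised sum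
    only mixes members of one convex set. *)
Lemma continuous_selection (K : ptopologicalType) (P : K -> set E) :
  compact [set: K] -> hausdorff_space K ->
  (forall t, convex_set_of (P t)) ->
  (forall t : K, exists v, \forall s \near t, P s v) ->
  exists2 g : K -> E, continuous g & forall t, P t (g t).
Proof.
move=> cK hK cP /choice[v vP].
have /choice[p pP] t := pointwise_bump cK hK (vP t).
have op t : open [set s | 0 < p t s].
  have [/continuousP cp _ _ _] := pP t.
  have := cp [set r : R | 0 < r] (@open_gt R 0).
  exact.
move: cK; rewrite compact_cover.
move=> /(_ K setT (fun t => [set s | 0 < p t s]) (fun t _ => op t))[t _|S _ cS].
  by exists t => //=; have [_ _ -> _] := pP t.
pose s : seq K := finmap.enum_fset S.
have sum_gt0 t : 0 < \sum_(i <- s) p i t.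
  have [i iS /= it] := cS t I.
  rewrite (big_rem i)//= ltr_wpDr// sumr_ge0// => j _.
  by have [_ + _ _] := pP j; apply.
exists (fun t => sMk k (\sum_(i <- s) p i t)^-1 0 *:
    \sum_(i <- s) sMk k (p i t) 0 *: v i).
  apply: scale_continuous.
    move=> t; apply: cvgV; first by rewrite gt_eqF.
    by apply: sum_continuousR => i; have [] := pP i.
  apply: sum_continuous => i; apply: scale_continuous; first by have [] := pP i.
  exact: cst_continuous.
move=> t; apply: convex_combination => //.
- by move=> i; have [_ + _ _] := pP i; apply.
- by move=> i it; have [_ _ _] := pP i; apply.
Qed.

End convexity.

Lemma rnorm_complete (R : realType) (k : scalar_kind)
    (E : completeNormedModType (scalar_field R k)) (u : nat -> E) :
  (forall e : R, 0 < e -> exists N, forall m n, (N <= m)%N -> (N <= n)%N ->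
     rnorm (u m - u n) < e) ->
  exists l, forall e : R, 0 < e -> exists N, forall n, (N <= n)%N -> rnorm (l - u n) < e.
Proof.
move=> cu.
have /cauchy_cvg cvgu : cauchy (u @ \oo).
  apply/cauchy_ballP => e e0.
  have eE : sMk k (sRe e) 0 = e by rewrite sMk_ge0E// ltW.
  have re0 : 0 < sRe e by rewrite -(sMk_gt0 k) eE.
  have [N HN] := cu _ re0.
  exists ([set v | exists2 m, (N <= m)%N & v = u m], [set v | exists2 m, (N <= m)%N & v = u m]).
    by split; exists N => // m /= Nm; exists m.
  move=> [_ _] [/= [m Nm ->] [n Nn ->]].
  by rewrite -ball_normE /ball_/= -eE sMk_lt//; exact: HN.
exists (lim (u @ \oo)) => e e0.
have [N _ HN] : \forall n \near \oo, rnorm (lim (u @ \oo) - u n) < e.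
  have := cvgu [set w | rnorm (lim (u @ \oo) - w) < e]; apply.
  by apply/nbhs_rnormP; exists e.
by exists N => n Nn; exact: HN.
Qed.

Lemma slice_continuous (S T : topologicalType) (s : S) :
  continuous (fun t : T => (s, t) : S * T).
Proof. by move=> t; exact: (cvg_pair (cvg_cst s) (@cvg_id _ _)). Qed.

(** * Majorants of superlinear functions *)

Section superlinear_functions.
Context (R : realType) (k : scalar_kind) (E : normedModType (scalar_field R k)).
Local Notation F := (scalar_field R k).
Local Notation WB := (weak_star_ball E).
Implicit Types (phi : cdual E -> R) (v w : E).

Lemma superlinear0 phi : superlinear phi -> phi 0 = 0.
Proof.
by move=> [_ /(_ 2 0)]; rewrite scaler0 => /(_ ltac:(lra)); lra.
Qed.

Lemma dnorm_unit (x : cdual E) : x <> 0 -> 0 < dnorm x.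
Proof.
move=> x0; rewrite lt_def Defs.dnorm_ge0 andbT; apply/eqP => nx.
exact/x0/dnorm_eq0.
Qed.

(** By homogeneity the error scales with the norm; for [c = 0] a comparison on the ball becomes one
    on the whole dual. *)
Lemma superlinear_le phi psi (c : R) : superlinear phi -> superlinear psi ->
  (forall y : WB, phi (sval y) <= psi (sval y) + c) ->
  forall y, phi y <= psi y + c * dnorm y.
Proof.
move=> sphi spsi h y.
have [->|/eqP y0] := eqVneq y 0.
  by rewrite dnorm_cdual0 mulr0 addr0 !superlinear0.
have ny := dnorm_unit y0.
pose u := sMk k (dnorm y)^-1 0 *: y.
have u1 : dnorm u <= 1 by rewrite dnormZr ?invr_ge0 ?(ltW ny)// mulVf// gt_eqF.
have yE : y = sMk k (dnorm y) 0 *: u.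
  by rewrite scalerA -sMkM divff ?gt_eqF// sMk1 scale1r.
have E1 theta : superlinear theta -> theta y = dnorm y * theta u.
  by move=> [_ thZ]; rewrite {1}yE thZ.
rewrite (E1 _ sphi) (E1 _ spsi) [c * _]mulrC -mulrDr ler_pM2l//.
exact: (h (exist _ u u1)).
Qed.

Lemma superlinear_eval v : superlinear (fun y : cdual E => sRe (y v)).
Proof.
by split=> [y z|a y _]; rewrite ?sRe_cdualZl// cdualD sReD.
Qed.

Lemma superlinear_zero : superlinear (fun y : cdual E => 0 : R).
Proof. by split=> [y z|a y _]; rewrite ?addr0 ?mulr0. Qed.

Lemma superlinearB phi v : superlinear phi ->
  superlinear (fun y => phi y - sRe (y v)).
Proof.
move=> [phiD phiZ]; split=> [y z|a y a0].
  by rewrite cdualD sReD; have := phiD y z; lra.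
by rewrite phiZ// sRe_cdualZl mulrBr.
Qed.

Lemma superlinear_concave phi (x y : cdual E) (a : R) : superlinear phi -> 0 <= a <= 1 ->
  a * phi x + (1 - a) * phi y <= phi (sMk k a 0 *: x + sMk k (1 - a) 0 *: y).
Proof.
move=> sphi /andP[a0 a1]; have [phiD phiZ] := sphi.
have Z (b : R) z : 0 <= b -> b * phi z = phi (sMk k b 0 *: z).
  rewrite le_eqVlt => /orP[/eqP <-|b0]; last by rewrite phiZ.
  by rewrite mul0r sMk00 scale0r superlinear0.
by rewrite !Z// subr_ge0.
Qed.

Lemma dnorm_convex (x y : cdual E) (a : R) : dnorm x <= 1 -> dnorm y <= 1 -> 0 <= a <= 1 ->
  dnorm (sMk k a 0 *: x + sMk k (1 - a) 0 *: y) <= 1.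
Proof.
move=> x1 y1 /andP[a0 a1]; rewrite (le_trans (ler_dnormD _ _))//.
by rewrite !dnormZr ?subr_ge0//; nra.
Qed.

Lemma eval_continuous v : continuous (fun y : WB => sRe (sval y v)).
Proof.
have ce : continuous (fun b : WB => sval b v : F^o).
  move=> b; apply: (@continuous_comp WB {ptws E -> F^o} F^o
    (fun (a : WB) w => sval a w) (fun h => h v)).
    exact: initial_continuous.
  exact: proj_continuous.
move=> b; exact: (@continuous_comp WB F^o R (fun a : WB => sval a v) (@sRe R k) b
  (ce b) (@sRe_continuous R k (sval b v))).
Qed.

(** The difference [phi] minus evaluation is affine in [v], and concave and upper semicontinuous in
    [y]; minimax thus replaces a [v] chosen for each [y] by a single one. *)
Lemma superlinear_minimax phi (C : set E) (e : R) :
  superlinear phi -> usc (fun y : WB => phi (sval y)) -> convex_set_of C ->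
  (forall y : WB, exists2 v, C v & phi (sval y) < sRe (sval y v) + e) ->
  exists2 v, C v & forall y : WB, phi (sval y) <= sRe (sval y v) + e.
Proof.
move=> sphi uphi cC neg.
have [| | | |v Cv hv] := @compact_minimax R E WB C
  (fun v y => phi (sval y) - sRe (sval y v) - e) (@weak_star_ball_compact R k E).
- move=> v1 v2 a C1 C2 a01.
  exists (sMk k a 0 *: v1 + sMk k (1 - a) 0 *: v2); first exact: cC.
  by move=> y; rewrite sRe_cdualD !sRe_cdualZr; lra.
- move=> y1 y2 a a01.
  have [y yE] : exists y : WB,
      sval y = sMk k a 0 *: sval y1 + sMk k (1 - a) 0 *: sval y2.
    by exists (exist (fun x : cdual E => is_true (dnorm x <= 1)) _
      (dnorm_convex (svalP y1) (svalP y2) a01)).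
  exists y => v _; rewrite yE.
  have := superlinear_concave (sval y1) (sval y2) sphi a01.
  by rewrite cdualD sReD !sRe_cdualZl; lra.
- move=> v _; apply: usc_open; apply: uscB; last exact: cst_continuous.
  by apply: uscB => //; exact: eval_continuous.
- by move=> y; have [v Cv hv] := neg y; exists v => //; lra.
by exists v => // y; have := hv y; lra.
Qed.

Lemma superlinear_majorant_bounded phi (c e : R) :
  superlinear phi -> usc (fun y : WB => phi (sval y)) -> 0 <= c -> 0 < e ->
  (forall y : WB, phi (sval y) <= c) ->
  exists2 v, rnorm v <= c & forall y : WB, phi (sval y) <= sRe (sval y v) + e.
Proof.
move=> sphi uphi c0 e0 phic.
apply: superlinear_minimax => //.
  move=> v w a /= vc wc /andP[a0 a1]; rewrite (le_trans (ler_rnormD _ _))//.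
  by rewrite !rnormZr !ger0_norm ?subr_ge0//; nra.
move=> y.
have phiy : phi (sval y) <= c * dnorm (sval y).
  have phi0c (z : WB) : phi (sval z) <= 0 + c by rewrite add0r.
  by have := superlinear_le sphi superlinear_zero phi0c (sval y); rewrite add0r.
have c1 : 0 < c + 1 by rewrite ltr_wpDl.
(* After scaling by [c] the loss is [c * (e / (c + 1))], strictly below [e], also when [c = 0]. *)
have ec : 0 < e / (c + 1) by rewrite divr_gt0.
have [v v1 yv] := dnorm_approx (sval y) ec.
exists (sMk k c 0 *: v); first by rewrite rnormZr ger0_norm// ler_piMr.
rewrite sRe_cdualZr; apply: le_lt_trans phiy _.
have eE : e = (c + 1) * (e / (c + 1)) by field; rewrite gt_eqF.
rewrite [X in _ < _ + X]eE; nra.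
Qed.

(** If one half-space lies in another, the kernel of Re x lies in that of Re y, so the two
    functionals are proportional; letting Re x tend to minus infinity fixes the sign of the
    factor. *)
Lemma half_space_inclusion (x y : cdual E) (a b : R) : x <> 0 ->
  (forall v, sRe (x v) <= a -> sRe (y v) <= b) ->
  exists2 s : R, 0 <= s & y = sMk k s 0 *: x /\ s * a <= b.
Proof.
move=> x0 xy.
have [v0 v01] : exists v, sRe (x v) = 1.
  apply: contrapT => nv; apply: x0; apply: cdual_ext => v.
  rewrite cdual0 sRe0; apply/eqP; apply: contrapT => /negP xv; apply: nv.
  by exists (sMk k (sRe (x v))^-1 0 *: v); rewrite sRe_cdualZr mulVf.
pose s := sRe (y v0).
have ker v : sRe (x v) = 0 -> sRe (y v) = 0.
  move=> xv; apply/eqP; apply: contrapT => /negP yv.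
  pose t := (b - a * s + 1) / sRe (y v).
  have := xy (sMk k a 0 *: v0 + sMk k t 0 *: v).
  rewrite !sRe_cdualD !sRe_cdualZr v01 xv mulr1 mulr0 addr0 lexx => /(_ isT).
  by rewrite /t divfK// -/s; lra.
have yE : y = sMk k s 0 *: x.
  apply: cdual_ext => v; rewrite sRe_cdualZl.
  have := ker (v - sMk k (sRe (x v)) 0 *: v0).
  rewrite !sRe_cdualB !sRe_cdualZr v01 mulr1 subrr => /(_ erefl).
  by rewrite -/s; lra.
exists s; last first.
  split => //; have := xy (sMk k a 0 *: v0).
  by rewrite !sRe_cdualZr v01 mulr1 lexx -/s mulrC => /(_ isT).
rewrite leNgt; apply/negP => s0.
(* For [s < 0] this choice gives [s * t >= b + 1], although [t <= a]. *)
pose t := Num.min a ((b + 1) / s).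
have := xy (sMk k t 0 *: v0); rewrite !sRe_cdualZr v01 mulr1 -/s.
move=> /(_ ltac:(by rewrite /t ge_min lexx)).
have : t <= (b + 1) / s by rewrite /t ge_min lexx orbT.
by rewrite ler_ndivlMr//; lra.
Qed.

(** Minimax over the half-space of [v] with Re x(v) at most [phi x + e]. If some [y] had no suitable
    [v] there, then [y = s x] with [s >= 0] and [s * (phi x + e) <= s * phi x - e], which is
    absurd. *)
Lemma superlinear_majorant_touching phi (x : WB) (e : R) :
  superlinear phi -> usc (fun y : WB => phi (sval y)) -> 0 < e ->
  sval x <> 0 ->
  exists2 v, sRe (sval x v) <= phi (sval x) + e &
    forall y : WB, phi (sval y) <= sRe (sval y v) + e.
Proof.
move=> sphi uphi e0 x0.
apply: superlinear_minimax => //.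
  move=> v w a /= vc wc /andP[a0 a1].
  by rewrite sRe_cdualD !sRe_cdualZr; nra.
move=> y; apply: contrapT => nv.
have [v /= vx|s s0 [yE]] :=
    @half_space_inclusion (sval x) (sval y) (phi (sval x) + e) (phi (sval y) - e) x0.
  by rewrite leNgt; apply/negP => lt; apply: nv; exists v => //; lra.
have -> : phi (sval y) = s * phi (sval x).
  rewrite yE; move: s0; rewrite le_eqVlt => /orP[/eqP <-|s0].
    by rewrite sMk00 scale0r mul0r superlinear0.
  by have [_ ->] := sphi.
nra.
Qed.

End superlinear_functions.

Section majorants.
Context (R : realType) (k : scalar_kind) (K : ptopologicalType).
Local Notation F := (scalar_field R k).

Definition usc_superlinear (E : normedModType F) (f : K -> cdual E -> R) :=
  usc (fun z : K * weak_star_ball E => f z.1 (sval z.2)) /\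
  forall t, superlinear (f t).

Section normed.
Context (E : normedModType F).
Local Notation WB := (weak_star_ball E).
Local Notation KB := (K * weak_star_ball E)%type.

Lemma usc_superlinear_slice (f : K -> cdual E -> R) (t : K) :
  usc_superlinear f -> usc (fun y : WB => f t (sval y)).
Proof. by move=> [uf _]; exact: (usc_comp (@slice_continuous K WB t) uf). Qed.

Lemma sRe_T_op_continuous (g : K -> E) : continuous g ->
  continuous (fun z : KB => sRe (T_op g z)).
Proof.
move=> cg z; apply: (@continuous_comp KB F^o R (T_op g) sRe); last exact: sRe_continuous.
exact: T_op_continuous.
Qed.

Lemma usc_superlinearB (f : K -> cdual E -> R) (g : K -> E) :
  usc_superlinear f -> continuous g ->
  usc_superlinear (fun t y => f t y - sRe (y (g t))).
Proof.
move=> [uf sf] cg; split=> [|t]; last exact: superlinearB.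
exact: (uscB uf (sRe_T_op_continuous cg)).
Qed.

(** The slack [d - e] makes the inequality hold near each point of the fibre over [t]; compactness
    of the ball turns this into a tube. *)
Lemma usc_majorant_near (f : K -> cdual E -> R) (t : K) (v : E) (e d : R) :
  usc_superlinear f -> e < d ->
  (forall y : WB, f t (sval y) <= sRe (sval y v) + e) ->
  \forall s \near t, forall y : WB, f s (sval y) <= sRe (sval y v) + d.
Proof.
move=> [uf sf] ed fv.
apply: (@compact_tube K WB t (fun z => f z.1 (sval z.2) <= sRe (sval z.2 v) + d)).
  exact: weak_star_ball_compact.
move=> y; have uv := uscB uf (sRe_T_op_continuous (@cst_continuous K E v)).
have de : 0 < d - e by rewrite subr_gt0.
apply: filterS (uv (t, y) _ de) => z; rewrite /T_op /=.
by have := fv y; lra.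
Qed.

Lemma bounded_majorant_approx (f : K -> cdual E -> R) (c e : R) :
  compact [set: K] -> hausdorff_space K -> usc_superlinear f -> 0 <= c -> 0 < e ->
  (forall t (y : WB), f t (sval y) <= c) ->
  exists g : K -> E, [/\ continuous g, forall t, rnorm (g t) <= c &
    forall t (y : WB), f t (sval y) <= sRe (sval y (g t)) + e].
Proof.
move=> cK hK uf c0 e0 fc.
pose P (t : K) := [set v : E | rnorm v <= c /\
  forall y : WB, f t (sval y) <= sRe (sval y v) + e].
have [||g cg gP] := @continuous_selection R k E K P cK hK.
- move=> t v w a [vc fv] [wc fw] /andP[a0 a1]; split.
    rewrite (le_trans (ler_rnormD _ _))// !rnormZr !ger0_norm ?subr_ge0//; nra.
  move=> y; rewrite sRe_cdualD !sRe_cdualZr.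
  by have := fv y; have := fw y; nra.
- move=> t.
  have e2 : 0 < e / 2 by rewrite divr_gt0.
  have [_ sf] := uf.
  have [v vc fv] := superlinear_majorant_bounded (sf t)
    (usc_superlinear_slice t uf) c0 e2 (fc t).
  exists v; have ee : e / 2 < e by lra.
  by apply: filterS (usc_majorant_near uf ee fv) => s fs; split.
by exists g; split => // t; have [] := gP t.
Qed.

End normed.

Lemma bounded_majorant (E : completeNormedModType F) (f : K -> cdual E -> R) (c : R) :
  compact [set: K] -> hausdorff_space K -> usc_superlinear f -> 0 < c ->
  (forall t (y : weak_star_ball E), f t (sval y) <= c) ->
  exists g : K -> E, [/\ continuous g, forall t, rnorm (g t) <= 2 * c &
    forall t y, f t y <= sRe (y (g t))].
Proof.
move=> cK hK uf c0 fc.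
(* Correct the error [c / 2 ^ n] of the [n]-th approximation by a function of norm
   at most [c / 2 ^ n]; the corrections are summable. *)
pose Inv n (g : K -> E) := continuous g /\
  forall t (y : weak_star_ball E), f t (sval y) <= sRe (sval y (g t)) + c / 2 ^+ n.
have cn n : 0 < c / 2 ^+ n by rewrite divr_gt0// exprn_gt0.
have step (p : nat * (K -> E)) : exists g' : K -> E, Inv p.1 p.2 ->
    Inv p.1.+1 g' /\ forall t, rnorm (g' t - p.2 t) <= c / 2 ^+ p.1.
  case: p => n g /=; have [[cg fg]|nI] := pselect (Inv n g); last by exists g => /nI.
  have [|h [ch hc fh]] := @bounded_majorant_approx E
    (fun t y => f t y - sRe (y (g t))) (c / 2 ^+ n) (c / 2 ^+ n.+1)
    cK hK (usc_superlinearB uf cg) (ltW (cn n)) (cn n.+1).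
    by move=> t y; have := fg t y; lra.
  exists (fun t => g t + h t) => _; split; last by move=> t; rewrite addrAC subrr add0r.
  split=> [t|t y]; first by apply: cvgD; [exact: cg|exact: ch].
  by rewrite sRe_cdualD; have := fh t y; lra.
have [G GP] := choice step.
pose u := fix u n := if n is m.+1 then G (m, u m) else (fun=> 0) : K -> E.
have uI n : Inv n (u n).
  elim: n => [|n ih]; last by have [] := GP (n, u n) ih.
  split=> [|t y]; first exact: cst_continuous.
  by rewrite /= linear0 sRe0 add0r expr0 divr1.
have du n t : rnorm (u n.+1 t - u n t) <= c / 2 ^+ n by have [_] := GP (n, u n) (uI n); apply.
(* The exact geometric sum, with its tail subtracted, is the form that passes through the
   induction. *)
have dum n m t : rnorm (u (m + n)%N t - u n t) <= 2 * c / 2 ^+ n - 2 * c / 2 ^+ (m + n).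
  elim: m => [|m ih]; first by rewrite add0n !subrr rnorm0.
  rewrite addSn -(subrK (u (m + n)%N t) (u (m + n).+1 t)) -addrA.
  rewrite (le_trans (ler_rnormD _ _))// (le_trans (lerD (du _ _) ih))//.
  have -> : 2 * c / 2 ^+ (m + n).+1 = c / 2 ^+ (m + n).
    by rewrite exprS invfM mulrACA divff ?mul1r// pnatr_eq0.
  have -> : 2 * c / 2 ^+ (m + n) = c / 2 ^+ (m + n) + c / 2 ^+ (m + n) by lra.
  lra.
have dumc n m t : (n <= m)%N -> rnorm (u m t - u n t) <= 2 * c / 2 ^+ n.
  move=> nm; rewrite -(subnK nm) (le_trans (dum _ _ _))// gerBl.
  by rewrite -mulrA mulr_ge0// ltW.
have small e : 0 < e -> exists N, 2 * c / 2 ^+ N < e.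
  move=> e0; pose N := Num.bound (2 * c / e); exists N.
  suff : 2 * c / e < 2 ^+ N by rewrite !ltr_pdivrMr ?exprn_gt0// [e * _]mulrC.
  have ce : 0 <= 2 * c / e by rewrite divr_ge0 ?mulr_ge0 ?(ltW c0) ?(ltW e0).
  rewrite (lt_le_trans (archi_boundP ce))// -/N -natrX ler_nat ltnW//.
  exact: ltn_expl.
have lim_u t : exists l, forall e : R, 0 < e -> exists N, forall n, (N <= n)%N ->
    rnorm (l - u n t) < e.
  apply: (@rnorm_complete R k E (fun n => u n t)) => e e0.
  have e2 : 0 < e / 2 by rewrite divr_gt0.
  have [N HN] := small _ e2; exists N => m n Nm Nn.
  have -> : u m t - u n t = (u m t - u N t) - (u n t - u N t).
    by rewrite opprB addrA subrK.
  rewrite (le_lt_trans (ler_rnormD _ _))// rnormN.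
  have := dumc _ _ t Nm; have := dumc _ _ t Nn; lra.
have [g gu] := choice lim_u.
have gun n t : rnorm (g t - u n t) <= 2 * c / 2 ^+ n.
  apply/ler_addgt0Pr => e e0; have [N HN] := gu t e e0.
  pose m := maxn N n.
  rewrite -(subrK (u m t) (g t)) -addrA (le_trans (ler_rnormD _ _))//.
  have := dumc n m t (leq_maxr _ _); have := HN m (leq_maxl _ _); lra.
exists g; split.
- move=> t A /nbhs_rnormP[e e0 eA].
  have e3 : 0 < e / 3 by rewrite divr_gt0.
  have [N HN] := small _ e3.
  have [cu _] := uI N.
  have uN : nbhs (u N t) [set v | rnorm (u N t - v) < e / 3].
    by apply/nbhs_rnormP; exists (e / 3).
  change (\forall s \near t, A (g s)).
  have us : \forall s \near t, rnorm (u N t - u N s) < e / 3 by exact: (cu t _ uN).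
  apply: filterS us => s us; apply: eA.
  have -> : g t - g s = (g t - u N t) + (u N t - u N s) - (g s - u N s).
    by rewrite addrA subrK opprB addrA subrK.
  rewrite (le_lt_trans (ler_rnormD _ _))// rnormN.
  have := ler_rnormD (g t - u N t) (u N t - u N s).
  have := gun N t; have := gun N s; lra.
- by move=> t; have := gun 0%N t; rewrite /= subr0 expr0 divr1.
- move=> t y.
  have [uf' sf] := uf.
  suff ball (z : weak_star_ball E) : f t (sval z) <= sRe (sval z (g t)) + 0.
    by have := superlinear_le (sf t) (superlinear_eval (g t)) ball y; rewrite mul0r addr0.
  rewrite addr0; move: z => {}y.
  apply/ler_addgt0Pr => e e0.
  have e2 : 0 < e / 2 by rewrite divr_gt0.
  have [N HN] := small _ e2; have [_ /(_ t y) fN] := uI N.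
  have : sRe (sval y (u N t - g t)) <= 2 * c / 2 ^+ N.
    rewrite (le_trans (ler_sRe_dnorm _ _))// (le_trans _ (gun N t))//.
    by rewrite -rnormN opprB ler_piMl ?rnorm_ge0//; exact: (svalP y).
  have := cn N; rewrite sRe_cdualB.
  have -> : 2 * c / 2 ^+ N = 2 * (c / 2 ^+ N) by rewrite mulrA.
  move: HN; have -> : 2 * c / 2 ^+ N = 2 * (c / 2 ^+ N) by rewrite mulrA.
  lra.
Qed.

End majorants.

(** * Measures with |T^* nu| = |nu| *)

Section bounded_measurable.
Context (R : realType) d (T : measurableType d).
Variable nu : {finite_measure set T -> \bar R}.
Implicit Types (f g : T -> R) (A B D : set T).

Definition bmf f := measurable_fun setT f /\ exists M : R, forall x, `|f x| <= M.

Lemma bmf_integrable D f : measurable D -> bmf f -> nu.-integrable D (EFin \o f).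
Proof.
move=> mD [mf [M fM]]; apply: measurable_bounded_integrable => //.
- by rewrite ltey_eq fin_num_measure.
- exact: measurable_funTS.
- exists M; split; rewrite ?num_real// => r Mr x _ /=.
  by rewrite (le_trans (fM x))// ltW.
Qed.

Lemma bmf_cst (r : R) : bmf (fun=> r).
Proof. by split; [exact: measurable_cst|exists `|r|]. Qed.

Lemma bmfD f g : bmf f -> bmf g -> bmf (fun x => f x + g x).
Proof.
move=> [mf [M fM]] [mg [N gN]]; split; first exact: measurable_funD.
by exists (M + N) => x; rewrite (le_trans (ler_normD _ _))// lerD.
Qed.

Lemma bmfZ (a : R) f : bmf f -> bmf (fun x => a * f x).
Proof.
move=> [mf [M fM]]; split; first exact: measurable_funM.
by exists (`|a| * M) => x; rewrite normrM ler_wpM2l.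
Qed.

Lemma bmfB f g : bmf f -> bmf g -> bmf (fun x => f x - g x).
Proof.
move=> bf bg; have := bmfD bf (bmfZ (-1) bg).
by under eq_fun do rewrite mulN1r.
Qed.

Lemma bmf_indic A : measurable A -> bmf (\1_A : T -> R).
Proof.
move=> mA; split; first exact: measurable_indic.
by exists 1 => x; rewrite indicE; case: (_ \in _); rewrite ?normr1 ?normr0.
Qed.

Lemma RintegralD_bmf D f g : measurable D -> bmf f -> bmf g ->
  \int[nu]_(x in D) (f x + g x) = \int[nu]_(x in D) f x + \int[nu]_(x in D) g x.
Proof. by move=> mD bf bg; rewrite RintegralD//; exact: bmf_integrable. Qed.

Lemma RintegralB_bmf D f g : measurable D -> bmf f -> bmf g ->
  \int[nu]_(x in D) (f x - g x) = \int[nu]_(x in D) f x - \int[nu]_(x in D) g x.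
Proof. by move=> mD bf bg; rewrite RintegralB//; exact: bmf_integrable. Qed.

Lemma RintegralZ_bmf D (a : R) f : measurable D -> bmf f ->
  \int[nu]_(x in D) (a * f x) = a * \int[nu]_(x in D) f x.
Proof. by move=> mD bf; rewrite RintegralZl//; exact: bmf_integrable. Qed.

Lemma le_Rintegral_bmf D f g : measurable D -> bmf f -> bmf g ->
  (forall x, D x -> f x <= g x) -> \int[nu]_(x in D) f x <= \int[nu]_(x in D) g x.
Proof. by move=> mD bf bg fg; apply: le_Rintegral => //; exact: bmf_integrable. Qed.

Lemma Rintegral_indic_bmf A : measurable A -> \int[nu]_x (\1_A x) = fine (nu A).
Proof.
by move=> mA; rewrite /Rintegral integral_indic// setIT.
Qed.

Lemma Rintegral_setC_bmf D f : measurable D -> bmf f ->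
  \int[nu]_x f x = \int[nu]_(x in D) f x + \int[nu]_(x in ~` D) f x.
Proof.
move=> mD bf; rewrite -Rintegral_setU ?setUv//; last by apply/disj_setPS; rewrite setICr.
  exact: measurableC.
exact: bmf_integrable.
Qed.

Lemma le_Rintegral_subset D f : measurable D -> bmf f -> (forall x, 0 <= f x) ->
  \int[nu]_(x in D) f x <= \int[nu]_x f x.
Proof.
move=> mD bf f0; rewrite (Rintegral_setC_bmf mD bf) lerDl.
by apply: Rintegral_ge0 => x _.
Qed.

Lemma markov_bmf f (c : R) : bmf f -> (forall x, 0 <= f x) ->
  c * fine (nu [set x | c <= f x]) <= \int[nu]_x f x.
Proof.
move=> bf f0; have [mf _] := bf.
have mA : measurable [set x | c <= f x].
  have -> : [set x | c <= f x] = f @^-1` `[c, +oo[.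
    by apply/seteqP; split=> x /=; rewrite in_itv/= andbT.
  by rewrite -[X in measurable X]setTI; exact: mf.
rewrite -Rintegral_cst//; apply: le_trans (le_Rintegral_subset mA bf f0).
by apply: le_Rintegral_bmf => //; exact: bmf_cst.
Qed.

Lemma abs_Rintegral_bmf D f (M : R) : measurable D -> bmf f ->
  (forall x, D x -> `|f x| <= M) -> `|\int[nu]_(x in D) f x| <= M * fine (nu D).
Proof.
move=> mD bf fM; rewrite -Rintegral_cst// ler_norml -mulN1r.
have bM := bmf_cst M.
rewrite -RintegralZ_bmf//; apply/andP; split; apply: le_Rintegral_bmf => //.
- exact: bmfZ.
- by move=> x Dx; have := fM x Dx; rewrite ler_norml => /andP[]; rewrite mulN1r.
- by move=> x Dx; rewrite (le_trans (ler_norm _))// fM.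
Qed.

End bounded_measurable.

(** * Radon measures *)

Section radon_measures.
Context (R : realType) (T : ptopologicalType).
Hypothesis hT : hausdorff_space T.

Lemma compact_borel (C : set T) : compact C -> measurable (C : set (Borel T)).
Proof. by move=> cC; apply: closed_borel; exact: compact_closed. Qed.

Lemma radon_inner (nu : radon_measure R T) (A : set (Borel T)) (e : R) :
  measurable A -> 0 < e ->
  exists C : set T, [/\ compact C, C `<=` A & (nu (A `\` C) <= e%:E)%E].
Proof.
move=> mA e0; have : borel_regular nu by case: nu.
move=> /(_ _ mA _ e0)[C [U [cC oU CA AU nuUC]]].
have mC := compact_borel cC.
exists C; split => //; apply: le_trans nuUC; apply: le_measure; rewrite ?inE.
- exact: measurableD.
- by apply: measurableD => //; exact: open_borel.
- by move=> x [Ax nC]; split => //; exact: AU.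
Qed.

Lemma radon_inner2 (nu1 nu2 : radon_measure R T) (A : set (Borel T)) (e : R) :
  measurable A -> 0 < e ->
  exists C : set T, [/\ compact C, C `<=` A, (nu1 (A `\` C) <= e%:E)%E &
    (nu2 (A `\` C) <= e%:E)%E].
Proof.
move=> mA e0.
have [C1 [cC1 C1A nu1C]] := radon_inner nu1 mA e0.
have [C2 [cC2 C2A nu2C]] := radon_inner nu2 mA e0.
have mC1 := compact_borel cC1; have mC2 := compact_borel cC2.
exists (C1 `|` C2); split.
- exact: compactU.
- by move=> x [/C1A|/C2A].
- apply: le_trans nu1C; apply: le_measure; rewrite ?inE; try exact: measurableD.
    by apply: measurableD => //; exact: measurableU.
  by move=> x [Ax nC]; split => // C1x; apply: nC; left.
- apply: le_trans nu2C; apply: le_measure; rewrite ?inE; try exact: measurableD.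
    by apply: measurableD => //; exact: measurableU.
  by move=> x [Ax nC]; split => // C2x; apply: nC; right.
Qed.

Lemma radon_normE (nu : radon_measure R T) : radon_norm nu = nu setT.
Proof.
apply/eqP; rewrite eq_le; apply/andP; split.
  apply: ge_ereal_sup => _ [n [P [mP tP PT ->]]].
  rewrite -PT bigcupT_ord measure_bigsetU_ord//.
  by apply: lee_sum => i _; rewrite gee0_abs.
apply: ereal_sup_ubound; exists 1%N, (fun=> setT); split => //.
- by move=> i j _ _ _; rewrite !ord1.
- by rewrite bigcupT_ord big_ord_recl big_ord0 setU0.
- by rewrite big_ord_recl big_ord0 adde0 gee0_abs.
Qed.

Lemma measure_eq_fine (nu : radon_measure R T) (A : set (Borel T)) :
  measurable A -> nu A = (fine (nu A))%:E.
Proof. by move=> mA; rewrite fineK// fin_num_measure. Qed.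

End radon_measures.

(** * Norming steps, marginals and graphs *)

Section adjoint_norm.
Context (R : realType) (k : scalar_kind) (K : ptopologicalType)
  (E : normedModType (scalar_field R k)).
Local Notation F := (scalar_field R k).
Local Notation WB := (weak_star_ball E).
Local Notation KB := (K * weak_star_ball E)%type.
Variable hK : hausdorff_space K.
Implicit Types nu : radon_measure R KB.

Lemma sbounded_bmf (h : Borel KB -> F) : sbounded h -> bmf (fun z => sRe (h z)).
Proof.
move=> [mre mim [M hM]]; split => //; exists M => z.
by rewrite (le_trans (ler_sRe_rnorm _)).
Qed.

Lemma sRe_Tadj nu (A : set (Borel K)) (v : E) : measurable A ->
  sRe (Tadj_fun nu A v) = \int[nu]_(z in A `*` setT) sRe (sval z.2 v).
Proof. by move=> mA; rewrite Tadj_funE// /Tadj_val sRe_scalar_integral. Qed.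

(** Working with real parts removes the factor 2 of [dnorm_Tadj]; equality of norms is only
    meaningful with the sharp constant. *)
Lemma dnorm_Tadj_le nu (A : set (Borel K)) : measurable A ->
  dnorm (Tadj_fun nu A) <= fine (nu (A `*` setT)).
Proof.
move=> mA; have mcA := @measurable_cylinder R k K E A mA.
apply: dnorm_leRe => [|v]; first by rewrite fine_ge0.
rewrite sRe_Tadj// mulrC (le_trans (ler_norm _))//.
apply: abs_Rintegral_bmf => //; first exact/sbounded_bmf/dual_eval_sbounded.
move=> z _; rewrite (le_trans (ler_normRe_dnorm _ _))//.
by rewrite ler_piMl ?rnorm_ge0//; exact: (svalP z.2).
Qed.

Lemma vmeasure_norm_Tadj_le nu : (vmeasure_norm (Tadj hK nu) <= nu setT)%E.
Proof.
apply: ge_ereal_sup => _ [n [P [mP tP PT ->]]].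
have -> : nu setT = (\sum_(i < n) nu (P i `*` setT))%E.
  rewrite -measure_bigsetU_ord.
  - rewrite -bigcupT_ord -setXTT -PT cylE preimage_bigcup.
    by under eq_bigcupr do rewrite -cylE.
  - by move=> i; exact: measurable_cylinder.
  - by move=> i j _ _ [z [[? _] [? _]]]; apply: tP => //; exists z.1.
apply: lee_sum => i _; rewrite [leRHS]measure_eq_fine; last exact: measurable_cylinder.
by rewrite lee_fin dnorm_Tadj_le.
Qed.

Lemma step_fun_in n (P : 'I_n -> set (Borel K)) (x : 'I_n -> E)
    (mP : forall j, measurable (P j)) (t : K) (i : 'I_n) :
  trivIset setT P -> P i t -> step_fun (Step x mP) t = x i.
Proof.
move=> tP Pit; rewrite /step_fun/= (bigD1 i)//= big1 => [|j ji].
  by rewrite addr0 indicE mem_set// scale1r.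
rewrite indicE memNset ?scale0r// => Pjt.
by move: ji; rewrite (tP j i I I (ex_intro _ t (conj Pjt Pit))) eqxx.
Qed.

Lemma step_fun_restrict n (P : 'I_n -> set (Borel K)) (x : 'I_n -> E) (A : set (Borel K))
    (mP : forall j, measurable (P j)) (mPA : forall j, measurable (P j `&` A)) (t : K) :
  step_fun (Step x mPA) t = (\1_A t : F) *: step_fun (Step x mP) t.
Proof.
rewrite /step_fun/= scaler_sumr; apply: eq_bigr => j _.
rewrite scalerA !indicE in_setI.
by case: (t \in P j); case: (t \in A); rewrite ?(mulr1, mulr0, scale0r).
Qed.

(** A partition nearly attaining the variation, with a nearly norming vector on each piece, gives
    [h]. Integrals of the step function over cylinders are values of T^* nu, so they agree for both
    measures. *)
Lemma norming_step nu1 nu2 (e : R) :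
  borel_eq (Tadj hK nu1) (Tadj hK nu2) -> nu1 setT = nu2 setT ->
  nu1 setT = vmeasure_norm (Tadj hK nu1) -> 0 < e ->
  exists h : K -> E,
  [/\ forall t, rnorm (h t) <= 1,
      bmf (fun z : Borel KB => sRe (T_op h z)),
      \int[nu1]_z (1 - sRe (T_op h z)) <= e,
      \int[nu2]_z (1 - sRe (T_op h z)) <= e &
      forall A : set (Borel K), measurable A ->
      \int[nu1]_(z in A `*` setT) sRe (T_op h z) =
      \int[nu2]_(z in A `*` setT) sRe (T_op h z)].
Proof.
move=> mu12 nu12 nu1n e0.
have fin1 : vmeasure_norm (Tadj hK nu1) \is a fin_num.
  by rewrite -nu1n fin_num_measure.
have e2 : 0 < e / 2 by rewrite divr_gt0.
have [_ [n [P [mP tP PT ->]]] lt] := ub_ereal_sup_adherent e2 fin1.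
have {}lt : fine (nu1 setT) - e / 2 < \sum_(i < n) dnorm (Tadj hK nu1 (P i)).
  rewrite -lte_fin EFinB -measure_eq_fine// nu1n (lt_le_trans lt)//.
  by rewrite sumEFin.
(* [K] has a point, so the partition has a piece; the error [d] per piece, [n] times, makes
   [e / 2]. *)
have n0 : (0 < n)%N.
  rewrite lt0n; apply/negP => /eqP n0; move: P mP tP PT lt; rewrite n0 => P _ _ PT _.
  have : [set: K] point by [].
  by rewrite -PT => -[[]].
pose d := e / (2 * n%:R).
have d0 : 0 < d by rewrite divr_gt0// mulr_gt0// ltr0n.
have /choice[x xP] (i : 'I_n) : exists v, rnorm v <= 1 /\
    dnorm (Tadj hK nu1 (P i)) - d < sRe (Tadj hK nu1 (P i) v).
  by have [v v1 lv] := dnorm_approx (Tadj hK nu1 (P i)) d0; exists v.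
pose s := Step x mP.
pose h := step_fun s.
have hx t : exists i, h t = x i.
  have : [set: K] t by [].
  by rewrite -PT => -[i _ Pit]; exists i; exact: step_fun_in.
have h1 t : rnorm (h t) <= 1 by have [i ->] := hx t; have [] := xP i.
have bh : bmf (fun z : Borel KB => sRe (T_op h z)).
  exact: (sbounded_bmf (step_int_Tadj nu1 hK s).1).
have key (A : set (Borel K)) : measurable A ->
    \int[nu1]_(z in A `*` setT) sRe (T_op h z) =
    \int[nu2]_(z in A `*` setT) sRe (T_op h z).
  move=> mA.
  have mPA j : measurable (P j `&` A) by exact: measurableI.
  pose sA := Step x mPA.
  have restr nu : \int[nu]_(z in A `*` setT) sRe (T_op h z) =
      sRe (step_int (Tadj hK nu) sA).
    rewrite (step_int_Tadj nu hK sA).2 sRe_scalar_integral Rintegral_mkcond.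
    apply: eq_Rintegral => z _; rewrite /T_op step_fun_restrict -/s -/h patchE.
    rewrite indicE in_setX in_setT andbT linearZ/=.
    by case: (z.1 \in A); rewrite ?scale1r// scale0r sRe0.
  rewrite !restr /step_int; congr sRe; apply: eq_bigr => j _.
    by have /= -> := mu12 _ (mPA j).
have b1h : bmf (fun z : Borel KB => 1 - sRe (T_op h z)).
  by apply: bmfB => //; exact: bmf_cst.
have int1 nu : \int[nu]_z (1 - sRe (T_op h z)) =
    fine (nu setT) - \int[nu]_z sRe (T_op h z).
  rewrite (RintegralB_bmf _ measurableT (bmf_cst _ 1) bh) Rintegral_cst// mul1r.
  by [].
have le1 : \int[nu1]_z (1 - sRe (T_op h z)) <= e.
  rewrite int1.
  have -> : \int[nu1]_z sRe (T_op h z) = sRe (step_int (Tadj hK nu1) s).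
    by rewrite (step_int_Tadj nu1 hK s).2 sRe_scalar_integral.
  have -> : sRe (step_int (Tadj hK nu1) s) = \sum_(i < n) sRe (Tadj hK nu1 (P i) (x i)).
    by rewrite /step_int /=; apply: (big_morph _ (@sReD R k) (sRe0 R k)).
  have : \sum_(i < n) (dnorm (Tadj hK nu1 (P i)) - d) <=
      \sum_(i < n) sRe (Tadj hK nu1 (P i) (x i)).
    by apply: ler_sum => i _; have [_ /ltW] := xP i.
  rewrite sumrB sumr_const card_ord -mulr_natr.
  have -> : d * n%:R = e / 2.
    by rewrite /d; field; rewrite ?pnatr_eq0 ?andbT -?lt0n.
  lra.
exists h; split => //.
by have := key _ measurableT; rewrite setXTT int1 -nu12 => <-; rewrite -int1.
Qed.

(** The function 1 - Re T h is nonnegative with integral at most [e], so the mass of a cylinder is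
    within [e] of the integral of Re T h over it, which depends only on T^* nu. *)
Lemma Tadj_marginals nu1 nu2 (A : set (Borel K)) :
  borel_eq (Tadj hK nu1) (Tadj hK nu2) -> nu1 setT = nu2 setT ->
  nu1 setT = vmeasure_norm (Tadj hK nu1) -> measurable A ->
  nu1 (A `*` setT) = nu2 (A `*` setT).
Proof.
move=> mu12 nu12 nu1n mA; have mcA := @measurable_cylinder R k K E A mA.
rewrite (measure_eq_fine nu1 mcA) (measure_eq_fine nu2 mcA).
congr EFin; apply/eqP; rewrite -subr_eq0 -normr_le0.
apply/ler_addgt0Pr => e e0; rewrite add0r.
have [h [h1 bh le1 le2 /(_ A mA) eqA]] := norming_step mu12 nu12 nu1n e0.
have b1h : bmf (fun z : Borel KB => 1 - sRe (T_op h z)).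
  by apply: bmfB => //; exact: bmf_cst.
have pos (z : Borel KB) : 0 <= 1 - sRe (T_op h z).
  rewrite subr_ge0 (le_trans (ler_sRe_dnorm _ _))// mulr_ile1 ?rnorm_ge0//.
  - exact: Defs.dnorm_ge0.
  - exact: (svalP z.2).
have bnd nu : \int[nu]_z (1 - sRe (T_op h z)) <= e ->
    0 <= fine (nu (A `*` setT)) - \int[nu]_(z in A `*` setT) sRe (T_op h z) <= e.
  move=> le; rewrite -[fine _]mul1r -Rintegral_cst//.
  rewrite -(RintegralB_bmf _ mcA (bmf_cst _ 1) bh); apply/andP; split.
    by apply: Rintegral_ge0 => z _; exact: pos.
  by apply: le_trans le; exact: le_Rintegral_subset.
have := bnd _ le1; have := bnd _ le2; rewrite eqA ler_norml.
move=> /andP[? ?] /andP[? ?]; apply/andP; split; lra.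
Qed.

Definition is_graph (G : set KB) := forall z w : KB, G z -> G w -> z.1 = w.1 -> z = w.

(* A common norming sequence [h n] satisfies [Re y (h n t) -> 1] at almost every
   [(t, y)] for both measures; by strict convexity this happens for at most one
   [y] above each [t]. *)
Lemma strictly_convex_graph nu1 nu2 : strictly_convex_dual E ->
  borel_eq (Tadj hK nu1) (Tadj hK nu2) -> nu1 setT = nu2 setT ->
  nu1 setT = vmeasure_norm (Tadj hK nu1) ->
  exists G : set (Borel KB), [/\ measurable G, is_graph G,
    forall z, G z -> sval z.2 <> 0, nu1 (~` G) = 0%E & nu2 (~` G) = 0%E].
Proof.
move=> sc mu12 nu12 nu1n.
pose c n : R := (2 ^ n.+1)%:R^-1.
have c0 n : 0 < c n by rewrite invr_gt0 ltr0n expn_gt0.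
(* By Markov, an integral at most [c n * c n] leaves measure at most [c n] to the set where the
   defect is at least [c n]. The [c n] are summable, so Borel-Cantelli applies to these sets. *)
have /choice[h hP] n := norming_step mu12 nu12 nu1n (mulr_gt0 (c0 n) (c0 n)).
pose f n (z : Borel KB) := 1 - sRe (T_op (h n) z).
have bf n : bmf (f n).
  by apply: bmfB; [exact: bmf_cst|have [] := hP n].
have f0 n z : 0 <= f n z.
  have [h1 _ _ _ _] := hP n.
  rewrite subr_ge0 (le_trans (ler_sRe_dnorm _ _))// mulr_ile1 ?rnorm_ge0//.
  - exact: Defs.dnorm_ge0.
  - exact: (svalP z.2).
pose B n := [set z | c n <= f n z].
have mB n : measurable (B n : set (Borel KB)).
  have -> : B n = f n @^-1` `[c n, +oo[.
    by apply/seteqP; split=> x /=; rewrite in_itv/= andbT.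
  by rewrite -[X in measurable X]setTI; apply: (bf n).1.
have null (nu : radon_measure R KB) : (forall n, \int[nu]_z f n z <= c n * c n) -> nu (lim_sup_set B) = 0%E.
  move=> le; apply: lim_sup_set_cvg0 => //.
  apply: (@le_lt_trans _ _ 1%:E); last exact: ltry.
  apply: le_trans (epsilon_trick0 xpredT ler01).
  apply: lee_nneseries => // n _.
  rewrite -[leLHS]fineK ?fin_num_measure// lee_fin div1r -(ler_pM2l (c0 n)).
  exact: le_trans (markov_bmf nu (c n) (bf n) (f0 n)) (le n).
have ev z : ~ lim_sup_set B z -> exists N, forall n, (N <= n)%N ->
    1 - c n < sRe (sval z.2 (h n z.1)).
  move=> nz; apply: contrapT => nN; apply: nz => n _; apply: contrapT => nn.
  apply: nN; exists n => m nm; rewrite ltNge; apply/negP => lt; apply: nn.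
  by exists m => //=; rewrite /B /f /T_op /=; lra.
have small e : 0 < e -> exists N, forall n, (N <= n)%N -> c n < e.
  move=> e0; exists (Num.bound e^-1) => n Nn.
  rewrite /c invf_plt ?posrE ?ltr0n ?expn_gt0//.
  have e0' : 0 <= e^-1 by rewrite invr_ge0 ltW.
  rewrite (lt_le_trans (archi_boundP e0'))// ler_nat (leq_trans Nn)//.
  by rewrite ltnW// ltnW// ltn_expl.
(* The steps have norm at most 1, so values tending to 1 force norm one. Strict convexity is stated
   for unit vectors, and 0 is thereby kept off the graph. *)
have one z : ~ lim_sup_set B z -> dnorm (sval z.2) = 1.
  move=> /ev[N HN]; apply/eqP; rewrite eq_le (svalP z.2)/=.
  apply/ler_addgt0Pr => e /small[N' HN'].
  have [h1 _ _ _ _] := hP (maxn N N').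
  have := HN _ (leq_maxl N N'); have := HN' _ (leq_maxr N N').
  have : sRe (sval z.2 (h (maxn N N') z.1)) <= dnorm (sval z.2).
    by rewrite (le_trans (ler_sRe_dnorm _ _))// ler_piMr// Defs.dnorm_ge0.
  lra.
exists (~` lim_sup_set B); split.
- apply: measurableC; apply: bigcap_measurable => // n _.
  by apply: bigcup_measurable.
- move=> z w Gz Gw zw.
  have [N HN] := ev _ Gz; have [N' HN'] := ev _ Gw.
  suff : sval z.2 = sval w.2.
    by case: z w zw {Gz Gw HN HN'} => [t x] [t' y] /= -> /val_inj ->.
  apply: contrapT => /(sc _ _ (one _ Gz) (one _ Gw)).
  apply/negP; rewrite -leNgt; apply/ler_addgt0Pr => e e0.
  have e2 : 0 < e / 2 by rewrite divr_gt0.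
  have [M HM] := small _ e2.
  pose m := maxn M (maxn N N').
  have := HN m (leq_trans (leq_maxl _ _) (leq_maxr _ _)).
  have := HN' m (leq_trans (leq_maxr _ _) (leq_maxr _ _)); rewrite -zw.
  have := HM m (leq_maxl _ _).
  have [h1 _ _ _ _] := hP m.
  have : sRe ((sval z.2 + sval w.2) (h m z.1)) <= dnorm (sval z.2 + sval w.2).
    by rewrite (le_trans (ler_sRe_dnorm _ _))// ler_piMr// Defs.dnorm_ge0.
  by rewrite cdualD sReD; lra.
- move=> z /one + z0; rewrite z0 dnorm_cdual0 => /esym/eqP.
  by rewrite oner_eq0.
- by rewrite setCK; apply: null => n; have [] := hP n.
- by rewrite setCK; apply: null => n; have [] := hP n.
Qed.

(* Inside the graph [G], a compact set [C] agrees with the cylinder over its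
   projection, so its measure is determined by the marginal. *)
Lemma graph_measure_eq nu1 nu2 (G : set (Borel KB)) : measurable G -> is_graph G ->
  nu1 (~` G) = 0%E -> nu2 (~` G) = 0%E ->
  (forall A : set (Borel K), measurable A -> nu1 (A `*` setT) = nu2 (A `*` setT)) ->
  borel_eq nu1 nu2.
Proof.
move=> mG gG nG1 nG2 marg A mA.
have hKB := @KB_hausdorff R k K E hK.
have key e : 0 < e -> exists C : set (Borel KB), [/\ measurable C, C `<=` A,
    nu1 C = nu2 C, (nu1 A <= nu1 C + e%:E)%E & (nu2 A <= nu2 C + e%:E)%E].
  move=> e0; have mAG := measurableI _ _ mA mG.
  have [C [cC CAG le1 le2]] := radon_inner2 hKB nu1 nu2 mAG e0.
  have mC := compact_borel hKB cC.
  pose D : set (Borel K) := fst @` C.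
  have mD : measurable D.
    apply: compact_borel => //; apply: continuous_compact => //.
    by apply: continuous_subspaceT => z; exact: cvg_fst.
  have mcD := @measurable_cylinder R k K E D mD.
  have CD nu : nu (~` G) = 0%E -> nu C = nu (D `*` setT).
    move=> nG; apply/eqP; rewrite eq_le; apply/andP; split.
      apply: le_measure; rewrite ?inE// => z Cz.
      by split => //; exists z.
    rewrite -(measureU0 mC (measurableC mG) nG).
    apply: le_measure; rewrite ?inE//.
      by apply: measurableU => //; exact: measurableC.
    move=> z [[w Cw wz] _]; have [Gz|Gz] := pselect (G z); last by right.
    by left; have [_ Gw] := CAG _ Cw; rewrite -(gG _ _ Gw Gz wz).
  have AC nu : nu (~` G) = 0%E -> (nu (A `&` G `\` C) <= e%:E)%E ->
      (nu A <= nu C + e%:E)%E.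
    move=> nG le.
    have mR : measurable (A `&` G `\` C : set (Borel KB)) by exact: measurableD.
    apply: (@le_trans _ _ (nu (C `|` (A `&` G `\` C)))); last first.
      by apply: le_trans (measureU2 _ mC mR) _; rewrite leeD2l.
    rewrite -(measureU0 (measurableU _ _ mC mR) (measurableC mG) nG).
    apply: le_measure; rewrite ?inE//.
      by apply: measurableU; [exact: measurableU|exact: measurableC].
    move=> z Az; have [Gz|Gz] := pselect (G z); last by right.
    by left; have [Cz|Cz] := pselect (C z); [left|right].
  exists C; split => //.
  - by move=> z /CAG[].
  - by rewrite CD// CD// marg.
  - exact: AC.
  - exact: AC.
apply/eqP; rewrite eq_le; apply/andP; split; apply/lee_addgt0Pr => e e0.
  have [C [mC CA C12 le1 _]] := key e e0.
  by rewrite (le_trans le1)// C12 leeD2r// le_measure// inE.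
have [C [mC CA C12 _ le2]] := key e e0.
by rewrite (le_trans le2)// -C12 leeD2r// le_measure// inE.
Qed.

Lemma strictly_convex_unique nu1 nu2 : strictly_convex_dual E ->
  borel_eq (Tadj hK nu1) (Tadj hK nu2) -> nu1 setT = nu2 setT ->
  nu1 setT = vmeasure_norm (Tadj hK nu1) -> borel_eq nu1 nu2.
Proof.
move=> sc mu12 nu12 nu1n.
have [G [mG gG _ G1 G2]] := strictly_convex_graph sc mu12 nu12 nu1n.
by apply: (graph_measure_eq mG gG G1 G2) => A mA; exact: Tadj_marginals.
Qed.

End adjoint_norm.

(** * The functional p_f *)

Section batty_functional.
Context (R : realType) (k : scalar_kind) (K : ptopologicalType)
  (E : completeNormedModType (scalar_field R k)).
Local Notation F := (scalar_field R k).
Local Notation WB := (weak_star_ball E).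
Local Notation KB := (K * weak_star_ball E)%type.
Hypotheses (cK : compact [set: K]) (hK : hausdorff_space K).
Implicit Types nu : radon_measure R KB.

Let hKB : hausdorff_space KB := @KB_hausdorff R k K E hK.

Lemma usc_bmf (T : ptopologicalType) (f : T -> R) (M : R) :
  usc f -> (forall z, `|f z| <= M) -> bmf (f : Borel T -> R).
Proof.
move=> uf fM; split; last by exists M.
apply: (measurability _ (RGenInftyO.measurableE R)).
move=> _ [_ [a ->] <-]; rewrite setTI; apply: open_borel.
have -> : f @^-1` `]-oo, a[ = [set x | f x < a].
  by apply/seteqP; split=> x /=; rewrite in_itv.
exact: usc_open.
Qed.

Lemma continuous_rnorm_bound (g : K -> E) : continuous g ->
  exists2 M : R, 0 <= M & forall t, rnorm (g t) <= M.
Proof.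
move=> cg.
have cn : continuous (fun t => rnorm (g t)).
  move=> t; exact: (@continuous_comp K E R g (@rnorm R k E) t (cg t)
    (@rnorm_continuous R k E (g t))).
have /compact_bounded[M [_ gM]] : compact [set rnorm (g t) | t in [set: K]].
  by apply: continuous_compact => //; exact: continuous_subspaceT.
have gM1 t : rnorm (g t) <= M + 1.
  by rewrite (le_trans (ler_norm _))// gM// ltrDl.
by exists (M + 1) => //; exact: le_trans (rnorm_ge0 _) (gM1 point).
Qed.

Lemma sRe_T_op_le (g : K -> E) (M : R) (z : KB) : rnorm (g z.1) <= M ->
  `|sRe (T_op g z)| <= M.
Proof.
move=> gM; rewrite (le_trans (ler_normRe_dnorm _ _))// (le_trans _ gM)//.
by rewrite ler_piMl ?rnorm_ge0//; exact: (svalP z.2).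
Qed.

Lemma sRe_T_op_bmf (g : K -> E) : continuous g ->
  bmf (fun z : Borel KB => sRe (T_op g z)).
Proof.
move=> cg; have [M _ gM] := continuous_rnorm_bound cg; split.
  by apply: continuous_measurable_borel; exact: sRe_T_op_continuous.
by exists M => z; exact: sRe_T_op_le.
Qed.

Lemma urysohn_bump (D V : set K) : closed D -> open V -> D `<=` V ->
  exists p : K -> R, [/\ continuous p, forall t, 0 <= p t <= 1,
    forall t, D t -> p t = 1 & forall t, ~ V t -> p t = 0].
Proof.
move=> cD oV DV.
have [|||p [cp p0 p1 pr]] :=
  @urysohn_ext_itv K R (compact_normal hK cK) (~` V) D 0 1 _ _ _ ltr01.
- exact: open_closedC.
- exact: cD.
- by apply/seteqP; split=> // s [/= + /DV].
exists p; split => //.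
- move=> t; have : range p (p t) by exists t.
  by move=> /pr; rewrite /= in_itv.
- by move=> t Dt; apply: p1; exists t.
- by move=> t Vt; apply: p0; exists t.
Qed.

(** Regularity on the product gives an open [U] around the compact cylinder over [D]; the tube lemma
    shrinks it to an open cylinder. *)
Lemma marginal_outer nu (D : set K) (e : R) : compact D -> 0 < e ->
  exists V : set K, [/\ open V, D `<=` V &
    (nu ((V `\` D) `*` setT) <= e%:E)%E].
Proof.
move=> cD e0.
have mD : measurable (D : set (Borel K)) by exact: compact_borel.
have mcD := @measurable_cylinder R k K E D mD.
have : borel_regular nu by case: nu.
move=> /(_ _ mcD _ e0)[C [U [cC oU CD DU nuUC]]].
pose V := interior [set t | forall y : WB, U (t, y)].
have oV : open V by exact: open_interior.
exists V; split => //.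
- move=> t Dt; apply: (@compact_tube K WB t U); first exact: weak_star_ball_compact.
  by move=> y; apply: open_nbhs_nbhs; split => //; exact: DU.
- apply: le_trans nuUC; apply: le_measure; rewrite ?inE.
  + apply: measurable_cylinder; apply: measurableD => //; exact: open_borel.
  + by apply: measurableD; [exact: open_borel|exact: compact_borel].
  + move=> [t y] [[/= Vt nD] _]; split; last by move=> /CD[].
    exact: (interior_subset Vt).
Qed.

Lemma marginal_inner nu (A : set (Borel K)) (e : R) : measurable A -> 0 < e ->
  exists C : set K, [/\ compact C, C `<=` A &
    (nu ((A `\` C) `*` setT) <= e%:E)%E].
Proof.
move=> mA e0; have mcA := @measurable_cylinder R k K E A mA.
have [C [cC CA nuC]] := radon_inner hKB nu mcA e0.
pose D : set K := fst @` C.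
have cD : compact D.
  apply: continuous_compact => //.
  by apply: continuous_subspaceT => z; exact: cvg_fst.
have mD : measurable (D : set (Borel K)) by exact: compact_borel.
exists D; split => //; first by move=> _ [z /CA[? _] <-].
apply: le_trans nuC; apply: le_measure; rewrite ?inE.
- by apply: measurable_cylinder; exact: measurableD.
- by apply: measurableD => //; exact: compact_borel.
- by move=> z [[zA zD] _]; split => // Cz; apply: zD; exists z.
Qed.

(* [C] is a union of compact subsets of the strips [a + i d <= f < a + (i+1) d];
   near a point of one strip, [C] has no points in the strips below it. *)
Lemma lusin_strips nu (f : Borel KB -> R) (d : R) n :
  0 < d -> measurable_fun setT f ->
  forall (G : set (Borel KB)) (a e : R), measurable G -> 0 < e ->
  (forall z, G z -> a <= f z < a + n%:R * d) ->
  exists C : set KB, [/\ compact C, C `<=` G, (nu (G `\` C) <= e%:E)%E &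
    forall z, C z -> \forall w \near z, C w -> f z - d <= f w].
Proof.
move=> d0 mf; elim: n => [|n ih] G a e mG e0 Gf.
  have G0 : G = set0.
    apply/seteqP; split=> // z /Gf; rewrite mul0r addr0 => /andP[? ?]; lra.
  exists set0; split => //; first exact: compact0.
  by rewrite G0 set0D measure0 lee_fin ltW.
pose b := a + n%:R * d.
have mb : measurable [set z | f z < b].
  have -> : [set z | f z < b] = f @^-1` `]-oo, b[.
    by apply/seteqP; split=> x /=; rewrite in_itv.
  by rewrite -[X in measurable X]setTI; exact: mf.
have mL := measurableI _ _ mG mb; have mH := measurableI _ _ mG (measurableC mb).
have e2 : 0 < e / 2 by rewrite divr_gt0.
have [|C1 [cC1 C1L nu1 f1]] := ih _ a _ mL e2.
  by move=> z [/Gf/andP[az _] zb]; rewrite az.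
have [C2 [cC2 C2H nu2]] := radon_inner hKB nu mH e2.
have clC1 : closed C1 by exact: compact_closed.
have mC1 : measurable (C1 : set (Borel KB)) by exact: compact_borel.
have mC2 : measurable (C2 : set (Borel KB)) by exact: compact_borel.
have f2 w : C2 w -> b <= f w by move=> /C2H[_] /negP; rewrite -leNgt.
exists (C1 `|` C2); split.
- exact: compactU.
- by move=> z [/C1L[]|/C2H[]].
- apply: (@le_trans _ _ (nu ((G `&` [set z | f z < b] `\` C1) `|`
      (G `&` ~` [set z | f z < b] `\` C2)))).
    apply: le_measure; rewrite ?inE.
    + by apply: measurableD => //; exact: measurableU.
    + by apply: measurableU; exact: measurableD.
    + move=> z [Gz nC]; have [zb|zb] := pselect (f z < b); [left|right].
        by split; [|move=> Cz; apply: nC; left].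
      by split; [|move=> Cz; apply: nC; right].
  apply: le_trans (measureU2 _ _ _) _; try exact: measurableD.
  have -> : e%:E = ((e / 2)%:E + (e / 2)%:E)%E by rewrite -EFinD -splitr.
  exact: leeD.
- move=> z [C1z|C2z].
    apply: filterS (f1 z C1z) => w fw [/fw//|/f2 bw].
    by have [_ /=] := C1L z C1z; lra.
  have nz : ~ C1 z by move=> /C1L[_ zb]; have [_ /=] := C2H z C2z; exact.
  have : nbhs z (~` C1) by apply: open_nbhs_nbhs; split => //; exact: closed_openC.
  apply: filterS => w nw [//|/f2 bw].
  have [/Gf/andP[_ +] _] := C2H z C2z.
  by rewrite -natr1 mulrDl mul1r -/b; move: bw; rewrite /b; lra.
Qed.

(** Over [t] the vector comes from the touching lemma if [C] meets the fibre, in a single point, and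
    from the bounded one otherwise; both err by [d]. Nearby, majorisation loses another [d].
    Touching loses two: one for the evaluation, one for the drop of [f] along [C]. *)
Lemma graph_majorant (f : K -> cdual E -> R) (C : set KB) (d M : R) :
  usc_superlinear f -> 0 <= M -> (forall t (y : WB), f t (sval y) <= M) ->
  compact C -> is_graph C -> (forall z, C z -> sval z.2 <> 0) -> 0 < d ->
  (forall z, C z -> \forall w \near z, C w ->
     f z.1 (sval z.2) - d <= f w.1 (sval w.2)) ->
  exists g : K -> E, [/\ continuous g,
    forall t (y : WB), f t (sval y) <= sRe (sval y (g t)) + 2 * d &
    forall z, C z -> sRe (sval z.2 (g z.1)) <= f z.1 (sval z.2) + 3 * d].
Proof.
move=> uf M0 fM cC gC C0 d0 fC.
have clC : closed C by exact: compact_closed.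
have [_ sf] := uf.
have d2 : d < 2 * d by lra.
pose P (t : K) := [set v : E |
  (forall y : WB, f t (sval y) <= sRe (sval y v) + 2 * d) /\
  (forall y : WB, C (t, y) -> sRe (sval y v) <= f t (sval y) + 3 * d)].
have [||g cg gP] := @continuous_selection R k E K P cK hK.
- move=> t v w a [fv Cv] [fw Cw] /andP[a0 a1]; split=> y => [|Cy];
    rewrite sRe_cdualD !sRe_cdualZr.
    by have := fv y; have := fw y; nra.
  by have := Cv y Cy; have := Cw y Cy; nra.
- move=> t; suff [v fv Cv] : exists2 v : E,
      (forall y : WB, f t (sval y) <= sRe (sval y v) + d) &
      forall y : WB, C (t, y) -> sRe (sval y v) <= f t (sval y) + d.
    exists v; have n1 := usc_majorant_near uf d2 fv.
    suff n2 : \forall s \near t, forall y : WB,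
        C (s, y) -> sRe (sval y v) <= f s (sval y) + 3 * d.
      by apply: filterS2 n1 n2 => s ? ?; split.
    apply: (@compact_tube K WB t
        (fun z => C z -> sRe (sval z.2 v) <= f z.1 (sval z.2) + 3 * d)).
      exact: weak_star_ball_compact.
    move=> y; have [Cty|nC] := pselect (C (t, y)); last first.
      have : nbhs ((t, y) : KB) (~` C).
        by apply: open_nbhs_nbhs; split => //; exact: closed_openC.
      by apply: filterS => z nz /nz.
    have := @sRe_T_op_continuous R k K E _ (@cst_continuous K E v) (t, y).
    move=> /cvgrPdist_lt/(_ _ d0) nv.
    apply: filterS2 nv (fC _ Cty) => z; rewrite /T_op/= ltr_norml => /andP[lt _] fz Cz.
    by have := fz Cz; have := Cv y Cty; lra.
  have [[y0 C0y]|nC] := pselect (exists y0 : WB, C (t, y0)); last first.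
    have [v _ fv] := superlinear_majorant_bounded (sf t)
      (usc_superlinear_slice t uf) M0 d0 (fM t).
    by exists v => // y Cy; exfalso; apply: nC; exists y.
  have [v y0v fv] := superlinear_majorant_touching (sf t)
    (usc_superlinear_slice t uf) d0 (C0 _ C0y).
  exists v => // y Cy.
  by have [->] := gC _ _ Cy C0y erefl.
exists g; split => //.
- by move=> t; have [] := gP t.
- by move=> [t y] Cty; have [_] := gP t; apply.
Qed.

Lemma superlinear_integral_majorant nu (G : set (Borel KB)) (f : K -> cdual E -> R)
    (M e : R) :
  measurable G -> is_graph G -> (forall z, G z -> sval z.2 <> 0) -> nu (~` G) = 0%E ->
  usc_superlinear f -> (forall z : KB, `|f z.1 (sval z.2)| <= M) -> 0 < e ->
  exists g : K -> E, [/\ continuous g, forall t x, f t x <= sRe (x (g t)) &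
    \int[nu]_z sRe (T_op g z) <= \int[nu]_z f z.1 (sval z.2) + e].
Proof.
move=> mG gG G0 nuG uf fM e0.
have M0 : 0 <= M by exact: le_trans (normr_ge0 _) (fM point).
have fleM t (y : WB) : f t (sval y) <= M by rewrite (le_trans (ler_norm _))// (fM (t, y)).
have fgeM (z : KB) : - M <= f z.1 (sval z.2).
  by have := fM z; rewrite ler_norml => /andP[].
have [usf sf] := uf.
have bf : bmf (fun z : Borel KB => f z.1 (sval z.2)) := usc_bmf usf fM.
set m := fine (nu setT).
have m0 : 0 <= m by rewrite fine_ge0.
(* Three errors of [e / 3]: [7 * d] everywhere, namely [3 * d] from touching and [4 * d] from the
   final correction; [2 * M] off [C], of measure at most [e1]; and [N + 2 * M] above [V] minus [D],
   of measure at most [e2]. *)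
pose d := e / (21 * (m + 1)).
have d0 : 0 < d by rewrite divr_gt0// mulr_gt0// ltr_wpDl.
pose e1 := e / (6 * (M + 1)).
have e10 : 0 < e1 by rewrite divr_gt0// mulr_gt0// ltr_wpDl.
have [C [cC CG nuC fC]] : exists C : set KB, [/\ compact C, C `<=` G,
    (nu (G `\` C) <= e1%:E)%E & forall z, C z -> \forall w \near z, C w ->
    f z.1 (sval z.2) - d <= f w.1 (sval w.2)].
  apply: (@lusin_strips nu _ d (Num.bound (2 * M / d)).+1 d0 bf.1 G (- M)) => // z _.
  rewrite fgeM/=.
  have : 2 * M / d < (Num.bound (2 * M / d))%:R.
    have Md : 0 <= 2 * M / d by rewrite divr_ge0 ?(ltW d0)// mulr_ge0.
    exact: archi_boundP.
  rewrite ltr_pdivrMr// -natr1 mulrDl mul1r.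
  by have := fleM z.1 z.2; lra.
have gC : is_graph C by move=> z w /CG Gz /CG Gw; exact: gG.
have C0 z : C z -> sval z.2 <> 0 by move=> /CG; exact: G0.
have [g [cg fg gCf]] := graph_majorant uf M0 fleM cC gC C0 d0 fC.
have [g0 [cg0 g0M fg0]] := bounded_majorant_approx cK hK uf M0 d0 fleM.
have [N N0 gN] := continuous_rnorm_bound cg.
pose D : set K := fst @` C.
have cD : compact D.
  apply: continuous_compact => //.
  by apply: continuous_subspaceT => z; exact: cvg_fst.
have clD : closed D by exact: compact_closed.
pose e2 := e / (3 * (N + 2 * M + 1)).
have NM : 0 < N + 2 * M + 1 by rewrite ltr_wpDl// addr_ge0// mulr_ge0.
have e20 : 0 < e2 by rewrite divr_gt0// mulr_gt0.
have [V [oV DV nuV]] := marginal_outer nu cD e20.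
have [p [cp p01 pD pV]] := urysohn_bump clD oV DV.
(* The norm of [g] is not controlled in terms of [e1], so [g] is cut off near the
   projection [D] of [C], where the marginal of [nu] is small outside [D]. *)
pose g1 t := sMk k (p t) 0 *: g t + sMk k (1 - p t) 0 *: g0 t.
have cg1 : continuous g1.
  move=> t; apply: cvgD; first exact: (scale_continuous cp cg).
  have cp' : continuous (fun t => 1 - p t).
    by move=> s; apply: cvgB; [exact: cvg_cst|exact: cp].
  exact: (scale_continuous cp' cg0).
have fg1 t (y : WB) : f t (sval y) <= sRe (sval y (g1 t)) + 2 * d.
  rewrite sRe_cdualD !sRe_cdualZr; have /andP[p0 p1] := p01 t.
  by have := fg t y; have := fg0 t y; nra.
have [||h [ch hd fh]] := @bounded_majorant R k K E
    (fun t y => f t y - sRe (y (g1 t))) (2 * d) cK hK (usc_superlinearB uf cg1).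
- by rewrite mulr_gt0.
- by move=> t y; have := fg1 t y; lra.
pose g2 t := g1 t + h t.
have cg2 : continuous g2 by move=> t; apply: cvgD; [exact: cg1|exact: ch].
exists g2; split => //.
  by move=> t x; rewrite sRe_cdualD; have := fh t x; lra.
have mC : measurable (C : set (Borel KB)) by exact: compact_borel.
have mnC := measurableC mC; have mnG := measurableC mG.
pose VD : set (Borel KB) := (V `\` D) `*` setT.
have mVD : measurable VD.
  apply: measurable_cylinder; apply: measurableD; first exact: open_borel.
  exact: compact_borel.
have g1g t : D t -> g1 t = g t.
  by move=> Dt; rewrite /g1 pD// subrr sMk00 sMk1 scale1r scale0r addr0.
have g1g0 t : ~ V t -> g1 t = g0 t.
  by move=> Vt; rewrite /g1 pV// subr0 sMk00 sMk1 scale1r scale0r add0r.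
have g1N t : rnorm (g1 t) <= N + M.
  rewrite (le_trans (ler_rnormD _ _))// !rnormZr; have /andP[p0 p1] := p01 t.
  rewrite !ger0_norm ?subr_ge0//.
  have := gN t; have := g0M t; have := rnorm_ge0 (g t); have := rnorm_ge0 (g0 t); nra.
have hT (z : KB) : sRe (T_op h z) <= 4 * d.
  have := sRe_T_op_le (g := h) (z := z) (hd z.1).
  by rewrite ler_norml => /andP[_]; lra.
have g1T (z : KB) : sRe (T_op g1 z) <= N + M.
  by have := sRe_T_op_le (z := z) (g1N z.1); rewrite ler_norml => /andP[].
(* On the graph above [D] touching applies. On the rest of the cylinder over [V], [g1] is bounded by
   [N + M], and off [V] it equals [g0], bounded by [M]; [f >= - M] turns these bounds into bounds by
   [f] plus a constant. *)
have key (z : Borel KB) : sRe (T_op g2 z) <= f z.1 (sval z.2) +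
    (7 * d + (N + 2 * M) * (\1_VD z + \1_(~` G) z) + 2 * M * \1_(~` C) z).
  have -> : sRe (T_op g2 z) = sRe (T_op g1 z) + sRe (T_op h z).
    by rewrite /T_op /g2 sRe_cdualD.
  have := hT z; have := fgeM z.
  have i0 (A : set (Borel KB)) : 0 <= \1_A z :> R by rewrite indicE ler0n.
  have NM0 : 0 <= N + 2 * M by rewrite addr_ge0// mulr_ge0.
  have M20 : 0 <= 2 * M by rewrite mulr_ge0.
  have t1 : 0 <= (N + 2 * M) * \1_VD z by rewrite mulr_ge0.
  have t2 : 0 <= (N + 2 * M) * \1_(~` G) z by rewrite mulr_ge0.
  have t3 : 0 <= 2 * M * \1_(~` C) z by rewrite mulr_ge0.
  have [Dz|nD] := pselect (D z.1).
    have [Gz|nG] := pselect (G z).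
      (* a point of the graph above [D] belongs to [C] *)
      have Cz : C z.
        by case: Dz => w Cw wz; rewrite (gG z w)//; exact: CG.
      have := gCf z Cz; rewrite -g1g// -/(T_op g1 z) mulrDr; lra.
    have : \1_(~` G) z = 1 :> R by rewrite indicE mem_set.
    move=> i1; have := g1T z; rewrite mulrDr; move: t2; rewrite i1; lra.
  have [Vz|nV] := pselect (V z.1).
    have : \1_VD z = 1 :> R by rewrite indicE mem_set.
    move=> i1; have := g1T z; rewrite mulrDr; move: t1; rewrite i1; lra.
  have : \1_(~` C) z = 1 :> R.
    by rewrite indicE mem_set//= => Cz; apply: nD; exists z.
  have := sRe_T_op_le (g := g0) (z := z) (g0M z.1).
  have -> : T_op g0 z = T_op g1 z by rewrite /T_op g1g0.
  by rewrite ler_norml mulrDr => /andP[_ ?] i1; move: t3; rewrite i1; lra.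
have bVD := bmf_indic R mVD; have bnG := bmf_indic R mnG; have bnC := bmf_indic R mnC.
have b1 := bmfD bVD bnG.
have b2 := bmfZ (N + 2 * M) b1.
have b3 := bmfD (bmf_cst (Borel KB) (7 * d)) b2.
have b4 := bmfZ (2 * M) bnC.
have b5 := bmfD b3 b4.
apply: le_trans (le_Rintegral_bmf nu measurableT (sRe_T_op_bmf cg2) (bmfD bf b5)
  (fun z _ => key z)) _.
rewrite (RintegralD_bmf nu measurableT bf b5) lerD2l.
rewrite (RintegralD_bmf nu measurableT b3 b4) (RintegralZ_bmf nu _ measurableT bnC).
rewrite (RintegralD_bmf nu measurableT (bmf_cst _ _) b2) (RintegralZ_bmf nu _ measurableT b1).
rewrite (RintegralD_bmf nu measurableT bVD bnG) !Rintegral_indic_bmf// Rintegral_cst// nuG.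
rewrite /= addr0 -/m.
have nuVD : fine (nu VD) <= e2.
  by rewrite -lee_fin fineK// fin_num_measure.
have nunC : fine (nu (~` C)) <= e1.
  rewrite -lee_fin fineK ?fin_num_measure//; apply: le_trans nuC.
  have mGC : measurable (G `\` C : set (Borel KB)) by exact: measurableD.
  rewrite -(measureU0 mGC mnG nuG); apply: le_measure; rewrite ?inE//.
    exact: measurableU.
  by move=> z nCz; have [Gz|Gz] := pselect (G z); [left|right].
have E1 : 7 * d * m <= e / 3.
  have -> : e / 3 = 7 * d * (m + 1) by rewrite /d; field; rewrite gt_eqF// ltr_wpDl.
  by rewrite ler_wpM2l// ?lerDl// mulr_ge0// ltW.
have E2 : (N + 2 * M) * fine (nu VD) <= e / 3.
  have -> : e / 3 = (N + 2 * M + 1) * e2 by rewrite /e2; field; rewrite gt_eqF.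
  have : 0 <= fine (nu VD) by rewrite fine_ge0.
  nra.
have E3 : 2 * M * fine (nu (~` C)) <= e / 3.
  have -> : e / 3 = 2 * (M + 1) * e1 by rewrite /e1; field; rewrite gt_eqF// ltr_wpDl.
  have : 0 <= fine (nu (~` C)) by rewrite fine_ge0.
  nra.
lra.
Qed.

(** This makes [nu] itself a candidate for W T^* nu. Every admissible [g] has integral at least that
    of [f], and [superlinear_integral_majorant] supplies nearly optimal ones. *)
Lemma batty_pE nu (G : set (Borel KB)) (f : K -> cdual E -> R) :
  measurable G -> is_graph G -> (forall z, G z -> sval z.2 <> 0) -> nu (~` G) = 0%E ->
  batty_D f -> (\int[nu]_z (f z.1 (sval z.2))%:E = batty_p f (Tadj hK nu))%E.
Proof.
move=> mG gG G0 nuG [/uscP usf [M fM] sf].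
have bf : bmf (fun z : Borel KB => f z.1 (sval z.2)) := usc_bmf usf fM.
have -> : (\int[nu]_z (f z.1 (sval z.2))%:E)%E = (\int[nu]_z f z.1 (sval z.2))%:E.
  rewrite /Rintegral fineK//; apply: integrable_fin_num => //.
  exact: (bmf_integrable nu measurableT bf).
have vE g : continuous g -> sRe (vint (Tadj hK nu) g) = \int[nu]_z sRe (T_op g z).
  by move=> cg; rewrite vint_Tadj// sRe_scalar_integral.
apply/eqP; rewrite eq_le; apply/andP; split.
  apply: le_ereal_inf_tmp => _ [g [cg fg] <-]; rewrite lee_fin vE//.
  by apply: le_Rintegral_bmf => //; exact: sRe_T_op_bmf.
apply/lee_addgt0Pr => e e0.
have [g [cg fg le]] := superlinear_integral_majorant mG gG G0 nuG (conj usf sf) fM e0.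
apply: ge_ereal_inf; exists (sRe (vint (Tadj hK nu) g))%:E; first by exists g.
by rewrite vE// -EFinD lee_fin.
Qed.

(** * Recovering T^* nu from integrals of continuous functions *)

Lemma T_op_batty_D (g : K -> E) : continuous g ->
  batty_D (fun t (x : cdual E) => sRe (x (g t))).
Proof.
move=> cg; split; last by move=> t; exact: superlinear_eval.
- apply/uscP => z e e0.
  have /cvgrPdist_lt/(_ _ e0) := @sRe_T_op_continuous R k K E g cg z.
  by apply: filterS => w; rewrite /T_op ltr_norml => /andP[]; lra.
- have [M _ gM] := continuous_rnorm_bound cg.
  by exists M => z; apply: (sRe_T_op_le (g := g)).
Qed.

(** For the test function given by [g], the map [g] itself is admissible in the infimum, which
    yields one inequality; [- g] yields the other. *)
Lemma batty_W_integral nu w (g : K -> E) : is_batty_W (Tadj hK nu) w -> continuous g ->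
  \int[w]_z sRe (T_op g z) = \int[nu]_z sRe (T_op g z).
Proof.
move=> [_ wp] cg.
have le g' : continuous g' -> \int[w]_z sRe (T_op g' z) <= \int[nu]_z sRe (T_op g' z).
  move=> cg'; have := wp _ (T_op_batty_D cg').
  have -> : (\int[w]_z (sRe (sval z.2 (g' z.1)))%:E)%E = (\int[w]_z sRe (T_op g' z))%:E.
    rewrite /Rintegral fineK//; apply: integrable_fin_num => //.
    exact: (bmf_integrable w measurableT (sRe_T_op_bmf cg')).
  rewrite -lee_fin => ->; apply: ge_ereal_inf.
  exists (sRe (vint (Tadj hK nu) g'))%:E; first by exists g'.
  by rewrite vint_Tadj// sRe_scalar_integral.
have cNg : continuous (fun t => - g t) by move=> t; apply: cvgN; exact: cg.
have neg nu' : \int[nu']_z sRe (T_op (fun t => - g t) z) = - \int[nu']_z sRe (T_op g z).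
  rewrite -mulN1r -(RintegralZ_bmf nu' _ measurableT (sRe_T_op_bmf cg)).
  by apply: eq_Rintegral => z _; rewrite mulN1r /T_op sRe_cdualN.
apply/eqP; rewrite eq_le le//= -lerN2 -!neg; exact: le.
Qed.

(** The bump [p] stands in for the indicator of [A]: the two differ only on [A] minus [C] and [V]
    minus [C], and there by at most 1. *)
Lemma Tadj_approx nu (A : set (Borel K)) (C V : set K) (p : K -> R) (v : E) (e : R) :
  measurable A -> compact C -> open V -> C `<=` A -> C `<=` V ->
  (nu ((A `\` C) `*` setT) <= e%:E)%E -> (nu ((V `\` C) `*` setT) <= e%:E)%E ->
  continuous p -> (forall t, 0 <= p t <= 1) -> (forall t, C t -> p t = 1) ->
  (forall t, ~ V t -> p t = 0) ->
  `|sRe (Tadj_fun nu A v) - \int[nu]_z sRe (T_op (fun t => sMk k (p t) 0 *: v) z)|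
    <= rnorm v * (2 * e).
Proof.
move=> mA cC oV CA CV nuA nuV cp p01 pC pV.
have mC : measurable (C : set (Borel K)) by exact: compact_borel.
have m1 : measurable ((A `\` C) `*` setT : set (Borel KB)).
  by apply: measurable_cylinder; exact: measurableD.
have m2 : measurable ((V `\` C) `*` setT : set (Borel KB)).
  by apply: measurable_cylinder; apply: measurableD => //; exact: open_borel.
have mcA := @measurable_cylinder R k K E A mA.
pose q (t : K) : E := sMk k (p t) 0 *: v.
change (`|sRe (Tadj_fun nu A v) - \int[nu]_z sRe (T_op q z)| <= rnorm v * (2 * e)).
have cq : continuous q by apply: scale_continuous => //; exact: cst_continuous.
have bq := sRe_T_op_bmf cq.
have bv : bmf (fun z : Borel KB => sRe (sval z.2 v : F)).
  exact/sbounded_bmf/dual_eval_sbounded.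
have bAv : bmf (fun z : Borel KB => \1_(A `*` setT) z * sRe (sval z.2 v)).
  have [mi [N iN]] := bmf_indic R mcA; have [mv [N' vN']] := bv.
  split; first exact: measurable_funM.
  by exists (N * N') => z; rewrite normrM ler_pM.
have -> : sRe (Tadj_fun nu A v) = \int[nu]_z (\1_(A `*` setT) z * sRe (sval z.2 v)).
  rewrite sRe_Tadj// Rintegral_mkcond; apply: eq_Rintegral => z _.
  by rewrite patchE indicE; case: (_ \in _); rewrite ?mul1r ?mul0r.
rewrite -(RintegralB_bmf nu measurableT bAv bq).
have bd := bmfB bAv bq.
have b1 := bmf_indic R m1; have b2 := bmf_indic R m2.
have b12 := bmfZ (rnorm v) (bmfD b1 b2).
have babs : bmf (fun z : Borel KB => `|\1_(A `*` setT) z * sRe (sval z.2 v) - sRe (T_op q z)|).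
  have [mg [N dN]] := bd; split; last by exists N => z; rewrite normr_id.
  exact: measurableT_comp.
apply: le_trans (le_normr_Rintegral measurableT (bmf_integrable nu measurableT bd)) _.
apply: (@le_trans _ _ (\int[nu]_z (rnorm v *
    (\1_((A `\` C) `*` setT) z + \1_((V `\` C) `*` setT) z)))).
  apply: le_Rintegral_bmf => // z _.
  have -> : sRe (T_op q z) = p z.1 * sRe (sval z.2 v) by rewrite /T_op sRe_cdualZr.
  rewrite -mulrBl normrM mulrC; apply: ler_pM => //.
    rewrite (le_trans (ler_normRe_dnorm _ _))// ler_piMl ?rnorm_ge0//.
    exact: (svalP z.2).
  rewrite !indicE !in_setX !in_setT !andbT.
  have /andP[p0 p1] := p01 z.1.
  have mem (B : set K) : B z.1 -> (z.1 \in B) = true by move=> Bz; apply/mem_set.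
  have nmem (B : set K) : ~ B z.1 -> (z.1 \in B) = false by move=> Bz; apply/memNset.
  have [Cz|nC] := pselect (C z.1).
    by rewrite (pC _ Cz) (mem A (CA _ Cz)) subrr normr0 addr_ge0.
  have [Az|nA] := pselect (A z.1).
    rewrite (mem A Az) (mem (A `\` C) (conj Az nC)) ler_wpDr//.
    by rewrite ger0_norm ?subr_ge0// gerBl.
  rewrite (nmem A nA) sub0r normrN ger0_norm// (nmem (A `\` C)) ?add0r; last by case.
  have [Vz|nV] := pselect (V z.1); first by rewrite (mem (V `\` C) (conj Vz nC)).
  by rewrite pV.
rewrite (RintegralZ_bmf nu _ measurableT (bmfD b1 b2)) ler_wpM2l ?rnorm_ge0//.
rewrite (RintegralD_bmf nu measurableT b1 b2) !Rintegral_indic_bmf//.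
have -> : 2 * e = e + e by lra.
by rewrite lerD// -lee_fin fineK// fin_num_measure.
Qed.

(** One bump must approximate [A] for both measures: [C] is the union of the inner compact sets, [V]
    the intersection of the outer open ones. Each measure errs by at most [rnorm v * (2 * d)]. *)
Lemma Tadj_eq nu1 nu2 :
  (forall g : K -> E, continuous g ->
     \int[nu1]_z sRe (T_op g z) = \int[nu2]_z sRe (T_op g z)) ->
  borel_eq (Tadj hK nu1) (Tadj hK nu2).
Proof.
move=> int12 A mA /=; apply: cdual_ext => v.
apply/eqP; rewrite -subr_eq0 -normr_le0; apply/ler_addgt0Pr => e e0; rewrite add0r.
have v4 : 0 < 4 * (rnorm v + 1) by rewrite mulr_gt0// ltr_wpDl// rnorm_ge0.
pose d := e / (4 * (rnorm v + 1)).
have d0 : 0 < d by rewrite divr_gt0.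
have [C1 [cC1 C1A nuC1]] := marginal_inner nu1 mA d0.
have [C2 [cC2 C2A nuC2]] := marginal_inner nu2 mA d0.
pose C := C1 `|` C2.
have cC : compact C by exact: compactU.
have CA : C `<=` A by move=> t [/C1A|/C2A].
have mC : measurable (C : set (Borel K)) by exact: compact_borel.
have [V1 [oV1 CV1 nuV1]] := marginal_outer nu1 cC d0.
have [V2 [oV2 CV2 nuV2]] := marginal_outer nu2 cC d0.
pose V := V1 `&` V2.
have oV : open V by exact: openI.
have CV : C `<=` V by move=> t Ct; split; [exact: CV1|exact: CV2].
have clC : closed C by exact: compact_closed.
have [p [cp p01 pC pV]] := urysohn_bump clC oV CV.
have mono nu (A1 A2 : set (Borel K)) : measurable A1 -> measurable A2 -> A1 `<=` A2 ->
    (nu (A2 `*` setT) <= d%:E)%E -> (nu (A1 `*` setT) <= d%:E)%E.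
  move=> mA1 mA2 A12; apply: le_trans; apply: le_measure; rewrite ?inE.
  - exact: measurable_cylinder.
  - exact: measurable_cylinder.
  - by move=> z [/A12].
have mD (B1 B2 : set (Borel K)) : measurable B1 -> measurable B2 ->
  measurable (B1 `\` B2) by exact: measurableD.
have mC1 : measurable (C1 : set (Borel K)) by exact: compact_borel.
have mC2 : measurable (C2 : set (Borel K)) by exact: compact_borel.
have mV1 : measurable (V1 : set (Borel K)) by exact: open_borel.
have mV2 : measurable (V2 : set (Borel K)) by exact: open_borel.
have mV : measurable (V : set (Borel K)) by exact: open_borel.
have AC1 : A `\` C `<=` A `\` C1.
  by move=> t [At nC]; split=> // C1t; apply: nC; left.
have AC2 : A `\` C `<=` A `\` C2.
  by move=> t [At nC]; split=> // C2t; apply: nC; right.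
have VC1 : V `\` C `<=` V1 `\` C by move=> t [[]].
have VC2 : V `\` C `<=` V2 `\` C by move=> t [[]].
have a1 := Tadj_approx (nu := nu1) v mA cC oV CA CV
  (mono nu1 _ _ (mD _ _ mA mC) (mD _ _ mA mC1) AC1 nuC1)
  (mono nu1 _ _ (mD _ _ mV mC) (mD _ _ mV1 mC) VC1 nuV1)
  cp p01 pC pV.
have a2 := Tadj_approx (nu := nu2) v mA cC oV CA CV
  (mono nu2 _ _ (mD _ _ mA mC) (mD _ _ mA mC2) AC2 nuC2)
  (mono nu2 _ _ (mD _ _ mV mC) (mD _ _ mV2 mC) VC2 nuV2)
  cp p01 pC pV.
have cq : continuous (fun t => sMk k (p t) 0 *: v).
  by apply: scale_continuous => //; exact: cst_continuous.
have eE : rnorm v * (2 * d) + rnorm v * (2 * d) <= e.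
  have -> : e = d * (4 * (rnorm v + 1)) by rewrite /d divfK// gt_eqF.
  by have := rnorm_ge0 v; nra.
move: a1 a2; rewrite (int12 _ cq) !ler_norml => /andP[? ?] /andP[? ?].
by apply/andP; split; lra.
Qed.

End batty_functional.

(** * Two-point measures and the equivalence *)

Section two_point_measure.
Context (R : realType) (T : ptopologicalType) (a b : Borel T).

(** For [a = b] this is a Dirac mass, so both measures of the counterexample are instances. *)
Definition two_point : set (Borel T) -> \bar R :=
  mscale (2^-1 : R)%:nng (measure_add \d_a \d_b).

HB.instance Definition _ := Measure.on two_point.

Lemma two_pointE (A : set (Borel T)) :
  two_point A = (2^-1 * (\1_A a + \1_A b))%:E.
Proof.
transitivity ((2^-1 : R)%:E * ((\d_a A : \bar R) + \d_b A))%E; last by rewrite /dirac -EFinD -EFinM.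
by congr (_ * _)%E; exact: measure_addE.
Qed.

Lemma two_point_finite : fin_num_fun two_point.
Proof. by move=> A mA; rewrite two_pointE. Qed.

HB.instance Definition _ := @Measure_isFinite.Build _ (Borel T) R two_point
  two_point_finite.

Lemma Rintegral_two_point (f : Borel T -> R) : bmf f ->
  \int[two_point]_z f z = 2^-1 * (f a + f b).
Proof.
move=> bf; have [mf [M fM]] := bf.
(* Shifted by its bound, [f] is nonnegative, as the integral formulas for scaled and added measures
   require. *)
have bfM : bmf (fun z => f z + M) by apply: bmfD => //; exact: bmf_cst.
have f0 z : 0 <= f z + M by have := fM z; rewrite ler_norml => /andP[]; lra.
have me : measurable_fun setT (fun z => (f z + M)%:E).
  by apply/measurable_EFinP; exact: bfM.1.
have : \int[two_point]_z (f z + M) = 2^-1 * ((f a + M) + (f b + M)).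
  rewrite /Rintegral ge0_integral_mscale//; last by move=> z _; rewrite lee_fin.
  rewrite ge0_integral_measure_add//; last by move=> z _; rewrite lee_fin.
  by rewrite !integral_dirac// !diracT !mul1e.
rewrite (RintegralD_bmf _ measurableT bf (bmf_cst _ M)) Rintegral_cst//.
rewrite -[X in _ + M * fine X]/(two_point setT) two_pointE !indicE !in_setT/=.
by lra.
Qed.

(** Take the atoms inside [A] as compact set and the complement of the atoms outside [A] as open
    set; their difference contains no atom. *)
Lemma two_point_regular : hausdorff_space T -> borel_regular two_point.
Proof.
move=> hT A mA e e0.
have cl1 := @accessible_closed_set1 T (hausdorff_accessible hT).
have cI (x : T) : compact (A `&` [set x]).
  have [Ax|nA] := pselect (A x).
    have -> : A `&` [set x] = [set x] by apply/seteqP; split=> [y []|y ->].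
    exact: compact_set1.
  have -> : A `&` [set x] = set0 by apply/seteqP; split=> // y [+ yx]; rewrite yx.
  exact: compact0.
have clD (x : T) : closed ([set x] `\` A).
  have [Ax|nA] := pselect (A x).
    have -> : [set x] `\` A = set0 by apply/seteqP; split=> // y [->].
    exact: closed0.
  have -> : [set x] `\` A = [set x] by apply/seteqP; split=> [y []|y ->].
  exact: cl1.
exists ((A `&` [set a]) `|` (A `&` [set b])),
  (~` (([set a] `\` A) `|` ([set b] `\` A))); split.
- exact: compactU.
- by apply: closed_openC; exact: closedU.
- by move=> x [[]|[]].
- by move=> x Ax [[_]|[_]]; exact.
- rewrite two_pointE !indicE !memNset ?addr0 ?mulr0 ?lee_fin ?ltW//.
    move=> [nD nC]; have [Ab|nA] := pselect (A b).
      by apply: nC; right.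
    by apply: nD; right.
  move=> [nD nC]; have [Aa|nA] := pselect (A a).
    by apply: nC; left.
  by apply: nD; left.
Qed.

Definition two_point_radon (hT : hausdorff_space T) : radon_measure R T :=
  RadonMeasure (two_point_regular hT).

End two_point_measure.

Section equivalences.
Context (R : realType) (k : scalar_kind) (K : ptopologicalType).
Local Notation F := (scalar_field R k).
Hypothesis hK : hausdorff_space K.

Section normed.
Variable E : normedModType F.
Local Notation WB := (weak_star_ball E).
Local Notation KB := (K * weak_star_ball E)%type.

Let hKB : hausdorff_space KB := @KB_hausdorff R k K E hK.

Lemma sRe_Tadj_two_point (t : K) (x y : WB) (A : set (Borel K)) (v : E) :
  measurable A ->
  sRe (Tadj_fun (two_point_radon R (t, x) (t, y) hKB) A v) =
  \1_A t * (2^-1 * sRe ((sval x + sval y) v)).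
Proof.
move=> mA; have mcA := @measurable_cylinder R k K E A mA.
have bv : bmf (fun z : Borel KB => sRe (sval z.2 v : F)).
  exact/sbounded_bmf/dual_eval_sbounded.
have bAv : bmf (fun z : Borel KB => \1_(A `*` setT) z * sRe (sval z.2 v)).
  have [mi [N iN]] := bmf_indic R mcA; have [mv [N' vN']] := bv.
  split; first exact: measurable_funM.
  by exists (N * N') => z; rewrite normrM ler_pM.
rewrite sRe_Tadj// Rintegral_mkcond.
transitivity (\int[two_point R ((t, x) : KB) (t, y)]_z
    (\1_(A `*` setT) z * sRe (sval z.2 v))).
  apply: eq_Rintegral => z _.
  by rewrite patchE indicE; case: (_ \in _); rewrite ?mul1r ?mul0r.
rewrite Rintegral_two_point// cdualD sReD !indicE !in_setX !in_setT !andbT/=.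
by lra.
Qed.

Lemma unique_strictly_convex :
  (forall nu1 nu2 : radon_measure R KB, borel_eq (Tadj hK nu1) (Tadj hK nu2) ->
     radon_norm nu1 = radon_norm nu2 ->
     radon_norm nu2 = vmeasure_norm (Tadj hK nu1) -> borel_eq nu1 nu2) ->
  strictly_convex_dual E.
Proof.
move=> uniq x y x1 y1 xy; rewrite ltNge; apply/negP => xy2.
pose m := sMk k 2^-1 0 *: (x + y).
have m1 : dnorm m = 1.
  have : dnorm (x + y) = 2.
    by apply/eqP; rewrite eq_le xy2 andbT (le_trans (ler_dnormD _ _))// x1 y1.
  by rewrite dnormZr ?invr_ge0// => ->; rewrite mulVf.
have ball (z : cdual E) : dnorm z = 1 -> exists u : WB, sval u = z.
  move=> z1; have le1 : dnorm z <= 1 by rewrite z1.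
  by exists (exist _ z le1).
have [X XE] := ball x x1; have [Y YE] := ball y y1; have [M ME] := ball m m1.
pose t : K := point.
pose nu1 := two_point_radon R ((t, M) : KB) (t, M) hKB.
pose nu2 := two_point_radon R ((t, X) : KB) (t, Y) hKB.
have n1 : nu1 setT = 1%E.
  by rewrite [LHS]two_pointE !indicE !in_setT mulVf.
have n2 : nu2 setT = 1%E.
  by rewrite [LHS]two_pointE !indicE !in_setT mulVf.
have T12 : borel_eq (Tadj hK nu1) (Tadj hK nu2).
  move=> A mA /=; apply: cdual_ext => v; rewrite !sRe_Tadj_two_point// XE YE ME.
  by rewrite cdualD sReD /m sRe_cdualZl; lra.
have T1 : Tadj_fun nu1 setT = m.
  apply: cdual_ext => v; rewrite sRe_Tadj_two_point// ME.
  have -> : \1_[set: K] t = 1 :> R by rewrite indicE in_setT.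
  by rewrite cdualD sReD; lra.
have norm1 : vmeasure_norm (Tadj hK nu1) = 1%E.
  apply/eqP; rewrite eq_le; apply/andP; split.
    by rewrite -n1; exact: vmeasure_norm_Tadj_le.
  apply: ereal_sup_ubound; exists 1%N, (fun=> setT); split => //.
  - by move=> i j _ _ _; rewrite !ord1.
  - by rewrite bigcupT_ord big_ord_recl big_ord0 setU0.
  - by rewrite big_ord_recl big_ord0 adde0 /= T1 m1.
(* This singleton tells the measures apart: [nu2] gives it at least 1/2, and [nu1] gives it 0, since
   [m = x] would force [x = y]. *)
pose S : set (Borel KB) := [set ((t, X) : KB)].
have mS : measurable S.
  apply: (@closed_borel KB).
  exact: (accessible_closed_set1 (hausdorff_accessible hKB)).
have : borel_eq nu1 nu2 by apply: uniq => //; rewrite !radon_normE ?n2 ?norm1 ?n1.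
move=> /(_ S mS); rewrite [LHS]two_pointE [RHS]two_pointE => -[].
rewrite !indicE.
have -> : (((t, M) : Borel KB) \in S) = false.
  apply/memNset => -[/(congr1 sval)]; rewrite ME XE => mx; apply: xy.
  apply: cdual_ext => v; have : sRe (m v) = sRe (x v) by rewrite mx.
  by rewrite sRe_cdualZl cdualD sReD; lra.
have -> : (((t, X) : Borel KB) \in S) = true by apply/mem_set.
by case: (_ \in _) => /=; lra.
Qed.

Lemma vmeasure_norm_borel_eq (mu1 mu2 : vmeasure K E) : borel_eq mu1 mu2 ->
  vmeasure_norm mu1 = vmeasure_norm mu2.
Proof.
move=> mu12; congr ereal_sup; apply/seteqP; split => _ [n [P [mP tP PT ->]]];
  exists n, P; split => //; apply: eq_bigr => i _; by rewrite mu12.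
Qed.

(** The predicates are equal, not just equivalent for each measure, so that [get] chooses the same
    measure for both. *)
Lemma is_batty_W_borel_eq (mu1 mu2 : vmeasure K E) : borel_eq mu1 mu2 ->
  is_batty_W mu1 = is_batty_W mu2.
Proof.
move=> mu12.
have stepE : step_int mu1 = step_int mu2.
  apply/funext => -[n A v mA]; rewrite /step_int /=.
  by apply: eq_bigr => j _; rewrite mu12.
have pE f : batty_p f mu1 = batty_p f mu2 by rewrite /batty_p /vint stepE.
apply/funext => w; apply/propext; rewrite /is_batty_W (vmeasure_norm_borel_eq mu12).
by split=> -[wn wp]; split=> // f /wp; rewrite pE.
Qed.

End normed.

(** Since [nu] satisfies the defining property, [get] returns a measure that satisfies it too. That
    measure has the same image under T^* and the same mass as [nu], so [strictly_convex_unique]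
    identifies them. *)
Lemma batty_W_unique (E : completeNormedModType F) (cK : compact [set: K])
    (nu : radon_measure R (K * weak_star_ball E)%type) :
  strictly_convex_dual E -> vmeasure_norm (Tadj hK nu) = radon_norm nu ->
  borel_eq (batty_W (Tadj hK nu)) nu.
Proof.
move=> sc nun.
have nunT : nu setT = vmeasure_norm (Tadj hK nu) by rewrite nun radon_normE.
have [G [mG gG G0 nuG _]] := @strictly_convex_graph R k K E hK nu nu sc
  (fun _ _ => erefl) erefl nunT.
have Wnu : is_batty_W (Tadj hK nu) nu.
  by split=> // f Df; exact: (batty_pE cK hK mG gG G0 nuG Df).
have WW : is_batty_W (Tadj hK nu) (batty_W (Tadj hK nu)).
  by apply: getPex; exists nu.
have TW : borel_eq (Tadj hK (batty_W (Tadj hK nu))) (Tadj hK nu).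
  apply: (Tadj_eq cK) => g cg; exact: (batty_W_integral cK WW cg).
have nW : batty_W (Tadj hK nu) setT = nu setT.
  by rewrite -!radon_normE -nun; case: WW.
apply: (strictly_convex_unique sc TW nW).
by rewrite nW nunT (vmeasure_norm_borel_eq TW).
Qed.

End equivalences.

Theorem theorem4p4 (R : realType) (k : scalar_kind) (K : ptopologicalType)
    (cK : compact [set: K]) (hK : hausdorff_space K)
    (E : completeNormedModType (scalar_field R k)) :
  [<-> strictly_convex_dual E;
       forall nu1 nu2 : radon_measure R (K * weak_star_ball E)%type,
         borel_eq (Tadj hK nu1) (Tadj hK nu2) ->
         radon_norm nu1 = radon_norm nu2 ->
         radon_norm nu2 = vmeasure_norm (Tadj hK nu1) ->
         borel_eq nu1 nu2;
       forall nu : radon_measure R (K * weak_star_ball E)%type,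
         vmeasure_norm (Tadj hK nu) = radon_norm nu ->
         borel_eq (batty_W (Tadj hK nu)) nu].
Proof.
tfae.
- move=> sc nu1 nu2 mu12; rewrite !radon_normE => n12 n2.
  by apply: (strictly_convex_unique sc mu12 n12); rewrite n12.
(* From (2) to (3) by way of (1). *)
- by move=> /unique_strictly_convex sc nu; exact: batty_W_unique.
(* From (3) to (1) by way of (2): both measures equal W of their common image, whatever [get]
   returns. *)
- move=> WT; apply: (@unique_strictly_convex R k K hK) => nu1 nu2 mu12 n12 n2 A mA.
  have n1 := etrans (esym n2) (esym n12).
  have n2' : vmeasure_norm (Tadj hK nu2) = radon_norm nu2.
    exact: etrans (esym (vmeasure_norm_borel_eq mu12)) (esym n2).
  rewrite -(WT _ n1 A mA) -(WT _ n2' A mA) /batty_W.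
  by rewrite (is_batty_W_borel_eq mu12).
Qed.
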